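(* Let $1<p<\infty$ and $0<s<1$. Let $\Omega\subset\mathbb{R}^N$ be an open set. Then for every $u\in C^\infty_0(\Omega)$ we have $$\frac{1}{2^{p(1-s)}\,N\,\omega_N}\,\|u\|^p_{\mathcal{D}^{s,p}_0(\Omega)}\le \|u\|^p_{\mathcal{X}^{s,p}_0(\Omega)}.$$ In particular, there is a continuous inclusion $\mathcal{X}^{s,p}_0(\Omega)\subset\mathcal{D}^{s,p}_0(\Omega)$.
   Context: $\omega_N$ is the Lebesgue measure of the unit ball $B_1(0)\subset\mathbb{R}^N$. $C^\infty_0(\Omega)$ is the space of smooth functions with compact support in $\Omega$ (extended by $0$ to $\mathbb{R}^N$). For $u\in C_0^\infty(\Omega)$ set $$\|u\|_{\mathcal{D}^{s,p}_0(\Omega)}:=[u]_{W^{s,p}(\mathbb{R}^N)}:=\left(\iint_{\mathbb{R}^N\times\mathbb{R}^N}\frac{|u(x)-u(y)|^p}{|x-y|^{N+sp}}\,dx\,dy\right)^{1/p},$$ and let $\mathcal{D}^{s,p}_0(\Omega)$ be the completion of $C^\infty_0(\Omega)$ with respect to this norm. For $t>0$ and $u\in C_0^\infty(\Omega)$ the $K$-functional is $$K(t,u,L^p(\Omega),\mathcal{D}^{1,p}_0(\Omega)):=\inf_{v\in C^\infty_0(\Omega)}\Big\{\|u-v\|_{L^p(\Omega)}+t\,\|\nabla v\|_{L^p(\Omega)}\Big\},$$ and $$\|u\|_{\mathcal{X}^{s,p}_0(\Omega)}:=\left(\int_0^{+\infty}\left(\frac{K(t,u,L^p(\Omega),\mathcal{D}^{1,p}_0(\Omega))}{t^s}\right)^p\frac{dt}{t}\right)^{1/p}.$$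 $\mathcal{X}^{s,p}_0(\Omega)$ is the completion of $C_0^\infty(\Omega)$ with respect to this norm. The continuous inclusion is the one induced on the completions by the identity of $C^\infty_0(\Omega)$. *)

(* Defs.v *)
From HB Require Import structures.
From mathcomp Require Import all_boot all_order all_algebra.
From mathcomp Require Import all_classical all_reals all_analysis.
Set Implicit Arguments.
Unset Strict Implicit.
Unset Printing Implicit Defensive.
Import Order.TTheory GRing.Theory Num.Theory.
Import numFieldNormedType.Exports.
Local Open Scope classical_set_scope.
Local Open Scope ring_scope.

(* The sigma-algebra on 'rV[T]_n generated by the coordinate projections; for
   T = R it is the Borel sigma-algebra of R^n. *)
Section measurable_rV.
Context {d} {T : measurableType d} (n : nat).

Let coord (i : 'I_n) (x : 'rV[T]_n) : T := x ord0 i.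

Let rV_set0 : g_sigma_preimage coord set0.
Proof. exact: sigma_algebra0. Qed.

Let rV_setC A : g_sigma_preimage coord A -> g_sigma_preimage coord (~` A).
Proof. exact: sigma_algebraC. Qed.

Let rV_bigcup (F : (set 'rV[T]_n)^nat) :
  (forall i, g_sigma_preimage coord (F i)) ->
  g_sigma_preimage coord (\bigcup_i (F i)).
Proof. exact: sigma_algebra_bigcup. Qed.

HB.instance Definition _ := @isMeasurable.Build (measure_tuple_display d)
  'rV[T]_n (g_sigma_preimage coord) rV_set0 rV_setC rV_bigcup.

Lemma measurable_coord (i : 'I_n) :
  measurable_fun [set: 'rV[T]_n] (fun x : 'rV[T]_n => x ord0 i).
Proof.
move=> _ Y mY; rewrite setTI; apply: sub_sigma_algebra => /=.
rewrite -bigcup_seq/=; exists i => /=; first by rewrite mem_index_enum.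
by exists Y => //; rewrite setTI.
Qed.

Lemma measurable_fun_rVP d1 (T1 : measurableType d1) (f : T1 -> 'rV[T]_n) :
  (forall i, measurable_fun [set: T1] (fun x => f x ord0 i)) ->
  measurable_fun [set: T1] f.
Proof.
move=> mf.
apply: (@measurability _ _ T1 'rV[T]_n [set: T1] f
  (\big[setU/set0]_(i < n) preimage_set_system setT (coord i) measurable)) => //.
move=> _ [A + <-]; rewrite -bigcup_seq/= => -[i _ [B mB <-]]; rewrite !setTI.
by rewrite -[X in measurable X]setTI; exact: mf.
Qed.

End measurable_rV.

Definition rV_cons (T : Type) (n : nat) (x : T) (v : 'rV[T]_n) : 'rV[T]_n.+1 :=
  \row_i oapp (v ord0) x (unlift ord0 i).

Section lebesgue_rV.
Context {R : realType}.

Section step.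
Variables (n : nat) (m : {sigma_finite_measure set 'rV[R]_n -> \bar R}).

Let cons (z : measurableTypeR R * 'rV[R]_n) : 'rV[R]_n.+1 := rV_cons z.1 z.2.

Lemma measurable_rV_cons : measurable_fun setT cons.
Proof.
apply: measurable_fun_rVP => i.
under eq_fun do rewrite mxE.
case: unliftP => [j _|_] /=.
  exact: (measurableT_comp (measurable_coord j) measurable_snd).
exact: measurable_fst.
Qed.

Definition lebesgue_rVS : set 'rV[R]_n.+1 -> \bar R :=
  pushforward (@lebesgue_measure R \x m)%E cons.

Let lebesgue_rVS0 : lebesgue_rVS set0 = 0%E.
Proof. by rewrite /lebesgue_rVS /pushforward preimage_set0 measure0. Qed.

Let lebesgue_rVS_ge0 A : (0 <= lebesgue_rVS A)%E.
Proof. by rewrite /lebesgue_rVS /pushforward measure_ge0. Qed.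

Let lebesgue_rVS_sigma_additive : semi_sigma_additive lebesgue_rVS.
Proof.
move=> F mF tF mUF; rewrite /lebesgue_rVS /pushforward preimage_bigcup.
apply: measure_semi_sigma_additive.
- by move=> k; rewrite -[X in measurable X]setTI; exact: measurable_rV_cons.
- apply/trivIsetP => /= i j _ _ ij; rewrite -preimage_setI.
  by move/trivIsetP : tF => /(_ _ _ _ _ ij) ->//; rewrite preimage_set0.
- by rewrite -preimage_bigcup -[X in measurable X]setTI;
    exact: measurable_rV_cons.
Qed.

HB.instance Definition _ := isMeasure.Build _ _ _ lebesgue_rVS
  lebesgue_rVS0 lebesgue_rVS_ge0 lebesgue_rVS_sigma_additive.

Let uncons (x : 'rV[R]_n.+1) : measurableTypeR R * 'rV[R]_n :=
  (x ord0 ord0, \row_i x ord0 (lift ord0 i)).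

Let consK : cancel cons uncons.
Proof.
case=> x v; rewrite /uncons /cons /rV_cons/= !mxE unlift_none/=; congr pair.
by apply/rowP => i; rewrite !mxE liftK.
Qed.

Let measurable_uncons : measurable_fun setT uncons.
Proof.
apply/measurable_fun_pairP; split => /=; first exact: measurable_coord.
apply: measurable_fun_rVP => i /=; under eq_fun do rewrite mxE.
exact: measurable_coord.
Qed.

Let lebesgue_rVS_sigma_finite : sigma_finite setT lebesgue_rVS.
Proof.
have /sigma_finiteP[F [TF ndF Foo]] := sigma_finiteT (@lebesgue_measure R).
have /sigma_finiteP[G [TG ndG Goo]] := sigma_finiteT m.
exists (fun k => uncons @^-1` (F k `*` G k)).
  rewrite -preimage_bigcup (_ : \bigcup_k (F k `*` G k) = setT)//.
  apply/seteqP; split => // -[t v] _.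
  have [i _ Fit] : (\bigcup_i F i) t by rewrite -TF.
  have [j _ Gjv] : (\bigcup_i G i) v by rewrite -TG.
  exists (maxn i j) => //; split => /=.
  - by move: t Fit; exact/subsetPset/ndF/leq_maxl.
  - by move: v Gjv; exact/subsetPset/ndG/leq_maxr.
move=> k; have [mF Fk] := Foo k; have [mG Gk] := Goo k; split.
  rewrite -[X in measurable X]setTI; apply: measurable_uncons => //.
  exact: measurableX.
rewrite /lebesgue_rVS /pushforward.
rewrite [X in (_ X < _)%E](_ : _ = F k `*` G k); last first.
  by apply/funext => z; rewrite -[z in RHS]consK.
by rewrite product_measure1E// lte_mul_pinfty// ge0_fin_numE.
Qed.

HB.instance Definition _ := Measure_isSigmaFinite.Build _ _ _ lebesgue_rVS
  lebesgue_rVS_sigma_finite.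

End step.

Fixpoint lebesgue_rV n : {sigma_finite_measure set 'rV[R]_n -> \bar R} :=
  if n is k.+1 then lebesgue_rVS (lebesgue_rV k) else \d_(0 : 'rV[R]_0).

Lemma lebesgue_rV_box n (A : 'I_n -> set (measurableTypeR R)) :
  (forall i, measurable (A i)) ->
  lebesgue_rV n [set x | forall i, A i (x ord0 i)] =
  (\prod_(i < n) lebesgue_measure (A i))%E.
Proof.
elim: n A => [|n IHn] A mA /=.
  by rewrite big_ord0 diracE mem_set// => -[].
rewrite big_ord_recl -IHn// -product_measure1E//; last first.
  rewrite [X in measurable X](_ : _ = \bigcap_(i in [set: 'I_n])
      ((fun x : 'rV[R]_n => x ord0 i) @^-1` A (lift ord0 i))).
    apply: fin_bigcap_measurable => // i _.
    rewrite -[X in measurable X]setTI.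
    exact: (measurable_coord i measurableT (mA (lift ord0 i))).
  by apply/seteqP; split => x /= => [h i _|h i]; exact: h.
rewrite /lebesgue_rVS /pushforward; congr (_ _); apply/seteqP; split.
  move=> [t v] /= h; split => [|i].
    by have := h ord0; rewrite mxE unlift_none.
  by have := h (lift ord0 i); rewrite mxE liftK.
move=> [t v] /= [At Av] i; rewrite mxE.
by case: unliftP => [j|] ->.
Qed.

End lebesgue_rV.
Arguments lebesgue_rV {R} n.

Definition enorm (R : realType) (n : nat) (x : 'rV[R]_n) : R :=
  Num.sqrt (\sum_(i < n) x ord0 i ^+ 2).

Definition unit_ball_volume (R : realType) (n : nat) : R :=
  fine (lebesgue_rV n [set x : 'rV[R]_n | enorm x < 1]).

Section test_functions.
Context {R : realType} {n : nat}.
Implicit Types u : 'rV[R]_n -> R.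

Definition partial (i : 'I_n) u : 'rV[R]_n -> R :=
  fun x => 'D_('e_i) u x.

Definition grad u (x : 'rV[R]_n) : 'rV[R]_n := \row_i partial i u x.

Definition iter_partial (l : seq 'I_n) u : 'rV[R]_n -> R :=
  foldr partial u l.

Definition smooth u : Prop := forall l : seq 'I_n,
  continuous (iter_partial l u) /\
  forall (i : 'I_n) (x : 'rV[R]_n), derivable (iter_partial l u) x 'e_i.

Definition tsupp u : set 'rV[R]_n := closure [set x | u x != 0].

(* C_0^oo(Omega), each function being identified with its extension by 0. *)
Definition Cc_infty (Omega : set 'rV[R]_n) : set ('rV[R]_n -> R) :=
  [set u | [/\ smooth u, compact (tsupp u) & tsupp u `<=` Omega]].

End test_functions.

Section norms.
Context {R : realType} {n : nat}.
Implicit Types (s p t : R) (Omega : set 'rV[R]_n) (u v : 'rV[R]_n -> R).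
Local Open Scope ereal_scope.

Definition Lp_norm p Omega u : \bar R :=
  Lnorm (lebesgue_rV n) p%:E (EFin \o (u \_ Omega)).

(* The integrand takes the value 0 on the (null) diagonal, as 0^-1 = 0. *)
Definition D_norm s p u : \bar R :=
  (\int[lebesgue_rV n \x lebesgue_rV n]_z
     ((`|u z.1 - u z.2| `^ p) / (enorm (z.1 - z.2) `^ (n%:R + s * p)))%R%:E)
  `^ p^-1.

Definition K_functional p Omega t u : \bar R :=
  ereal_inf [set Lp_norm p Omega (u \- v)%R +
                 t%:E * Lp_norm p Omega (fun x => enorm (grad v x))
            | v in Cc_infty Omega].

Definition X_norm s p Omega u : \bar R :=
  (\int[lebesgue_measure]_(t in `]0%R, +oo[)
     ((K_functional p Omega t u * ((t `^ s)^-1)%R%:E) `^ p * (t^-1)%R%:E))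
  `^ p^-1.

End norms.

(* [iota] exhibits the Banach space [E] as the completion of the vector space
   of functions [V] with respect to the norm [N]: it is linear and isometric
   on [V], with dense image. Its values outside [V] are irrelevant. *)
Definition is_completion (R : realType) (T : Type) (V : set (T -> R))
    (N : (T -> R) -> \bar R) (E : completeNormedModType R)
    (iota : (T -> R) -> E) : Prop :=
  [/\ forall (a : R) (u v : T -> R), V u -> V v ->
        iota (fun x => a * u x + v x) = a *: iota u + iota v,
      forall u, V u -> (`|iota u|)%:E = N u &
      dense (iota @` V)].

(* Main.v *)
Require Import Defs.
From HB Require Import structures.
From mathcomp Require Import all_boot all_order all_algebra.
From mathcomp Require Import all_classical all_reals all_analysis.
From mathcomp Require Import measurable_realfun ring.
Set Implicit Arguments.
Unset Strict Implicit.
Unset Printing Implicit Defensive.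
Import Order.TTheory GRing.Theory Num.Theory.
Import numFieldNormedType.Exports.
Local Open Scope classical_set_scope.
Local Open Scope ring_scope.

(* For test functions [u], [v] and a shift [h], Minkowski's inequality and the
   estimate [||v(. + h) - v||_p <= |h| ||grad v||_p] give
     [||u(. + h) - u||_p <= 2 ||u - v||_p + |h| ||grad v||_p],
   hence [||u(. + h) - u||_p <= 2 K(|h| / 2, u)]. Raising this to the power [p],
   integrating against [|h|^(- N - s p) dh] and passing to polar coordinates
   [|h| = 2 t] gives the inequality; [2^p] from the factor [2] and [2^(- s p)]
   from the change of variable make the constant [2^(p (1 - s))]. The inclusion
   is the extension by density of the identity, which this bound makes
   Lipschitz. *)

(** * Lebesgue measure on the line under translations and dilations *)

Section lebesgue1.
Context {R : realType}.
Implicit Types (f : R -> \bar R) (a c t : R).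
Local Open Scope ereal_scope.
Local Notation leb := (@lebesgue_measure R).

(** Two encodings shape the work. [lebesgue_rV] is an iterated product, so invariance under
    translations and homogeneity under dilations are proved on the line and lifted by induction on
    the dimension. Translations serve the increments and the double integral of [D_norm]; dilations
    serve the radial integration, where [N * omega_N] arises directly as [n] times the measure of
    the unit ball, without a measure on the sphere. Next, [smooth] speaks of partial derivatives
    only, so the derivative along an arbitrary vector [h] has to be assembled from them before the
    segment from [x] to [x + h] can be used. The factor 2 is the price of writing [u] as
    [(u - v) + v]: the difference [u - v] enters once shifted and once unshifted. All integrals are
    taken in the extended reals, so the inequality is proved whether or not either side is finite;
    only the unit ball has to be shown of finite measure, because its volume is stated as a real
    number. *)

Lemma ge0_integral_translation a f :
  measurable_fun [set: R] f -> (forall t, 0 <= f t) ->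
  \int[leb]_t f (t + a)%R = \int[leb]_t f t.
Proof.
move=> mf f0.
pose phi : measurableTypeR R -> measurableTypeR R := fun t => (t + a)%R.
have mphi : measurable_fun setT phi by exact: measurable_funD.
rewrite -[LHS]/(\int[leb]_(t in phi @^-1` setT) (f \o phi) t).
rewrite -ge0_integral_pushforward//.
apply: eq_measure_integral => //= A mA _; apply/esym.
(* The image measure gives each half-open interval its length, which characterises Lebesgue
   measure. *)
apply: (@lebesgue_measure_unique R (pushforward leb phi)) => //= _ [[b c] _ <-].
rewrite /pushforward [phi @^-1` _](_ : _ = `](b - a)%R, (c - a)%R]%classic); last first.
  by apply/seteqP; split => t /=; rewrite !in_itv/= ltrBlDr lerBrDr.
by rewrite !lebesgue_measure_itv/= !lte_fin ltrD2r -!EFinB opprB addrA subrK.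
Qed.

Lemma ge0_integral_dilation c f : (0 < c)%R ->
  measurable_fun [set: R] f -> (forall t, 0 <= f t) ->
  \int[leb]_t f (c * t)%R = c^-1%:E * \int[leb]_t f t.
Proof.
move=> c0 mf f0.
pose phi : measurableTypeR R -> measurableTypeR R := fun t => (c * t)%R.
have mphi : measurable_fun setT phi by exact: measurable_funM.
rewrite -[LHS]/(\int[leb]_(t in phi @^-1` setT) (f \o phi) t).
rewrite -ge0_integral_pushforward//.
have ci0 : (0 <= c^-1)%R by rewrite invr_ge0 ltW.
rewrite -[c^-1%:E]/((NngNum ci0)%:num%:E).
rewrite -ge0_integral_mscale//.
apply: eq_measure_integral => //= A mA _.
(* The factor [c] is inserted because [c] times the image measure is the one that gives intervals
   their length, so uniqueness applies to it. *)
have -> : pushforward leb phi A = c^-1%:E * (c%:E * pushforward leb phi A).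
  by rewrite muleA -EFinM mulVf ?gt_eqF// mul1e.
rewrite /mscale/=; congr (_ * _); apply/esym.
pose cn := NngNum (ltW c0).
apply: (@lebesgue_measure_unique R (mscale cn (pushforward leb phi))) => //= _ [[a b] _ <-].
rewrite /mscale /= /pushforward [phi @^-1` _](_ : _ = `](c^-1 * a)%R, (c^-1 * b)%R]%classic); last first.
  apply/seteqP; split => t /=; rewrite !in_itv/= /phi.
    by rewrite ltr_pdivrMl// ler_pdivlMl.
  by rewrite ltr_pdivrMl// ler_pdivlMl.
rewrite !lebesgue_measure_itv/= !lte_fin ltr_pM2l ?invr_gt0//.
case: ifPn => _; last by rewrite mule0.
by rewrite -!EFinB -EFinM -mulrBr mulrA divff ?gt_eqF// mul1r.
Qed.
End lebesgue1.

(** * Tonelli, translations and dilations in higher dimension *)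

Section lebesgue_rV_integral.
Context {R : realType}.
Local Open Scope ereal_scope.
Local Notation leb := (@lebesgue_measure R).
Local Notation L n := (@lebesgue_rV R n).

Lemma ge0_integral_rVS n (f : 'rV[R]_n.+1 -> \bar R) :
  measurable_fun setT f -> (forall x, 0 <= f x) ->
  \int[L n.+1]_x f x = \int[leb]_t \int[L n]_v f (rV_cons t v).
Proof.
move=> mf f0.
have mc := @measurable_rV_cons R n.
rewrite [LHS](ge0_integral_pushforward mc)//.
rewrite preimage_setT fubini_tonelli1//.
- exact: measurableT_comp.
- by move=> z; exact: f0.
Qed.

Lemma measurable_rV_add n (a : 'rV[R]_n) : measurable_fun setT (fun x : 'rV[R]_n => (x + a)%R).
Proof.
apply: measurable_fun_rVP => i; under eq_fun do rewrite mxE.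
by apply: measurable_funD => //; exact: measurable_coord.
Qed.

Lemma measurable_rV_scale n (c : R) : measurable_fun setT (fun x : 'rV[R]_n => (c *: x)%R).
Proof.
apply: measurable_fun_rVP => i; under eq_fun do rewrite mxE.
by apply: measurable_funM => //; exact: measurable_coord.
Qed.

Lemma rV_consD n (t t' : R) (v v' : 'rV[R]_n) :
  (rV_cons t v + rV_cons t' v' = rV_cons (t + t') (v + v'))%R.
Proof. by apply/rowP => i; rewrite !mxE; case: unliftP => [j|] _ /=; rewrite ?mxE. Qed.

Lemma rV_consZ n (c t : R) (v : 'rV[R]_n) :
  (c *: rV_cons t v = rV_cons (c * t) (c *: v))%R.
Proof. by apply/rowP => i; rewrite !mxE; case: unliftP => [j|] _ /=; rewrite ?mxE. Qed.

Lemma rV_consE n (x : 'rV[R]_n.+1) :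
  x = rV_cons (x ord0 ord0) (\row_i x ord0 (lift ord0 i)).
Proof. by apply/rowP => i; rewrite !mxE; case: unliftP => [j|] -> /=; rewrite ?mxE. Qed.

Lemma measurable_rV_cons_l n (t : R) : measurable_fun setT (fun v : 'rV[R]_n => rV_cons t v).
Proof.
exact: (measurableT_comp (@measurable_rV_cons R n) (measurable_pair1 t)).
Qed.

Lemma measurable_integral_rV_cons n (f : 'rV[R]_n.+1 -> \bar R) :
  measurable_fun setT f -> (forall x, 0 <= f x) ->
  measurable_fun [set: R] (fun t => \int[L n]_v f (rV_cons t v)).
Proof.
move=> mf f0.
apply: (@measurable_fun_fubini_tonelli_F _ _ (measurableTypeR R) _ _ (L n) (fun z => f (rV_cons z.1 z.2))) => //.
exact: (measurableT_comp mf (@measurable_rV_cons R n)).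
Qed.

Lemma ge0_integral_rV_translation n (a : 'rV[R]_n) (f : 'rV[R]_n -> \bar R) :
  measurable_fun setT f -> (forall x, 0 <= f x) ->
  \int[L n]_x f (x + a)%R = \int[L n]_x f x.
Proof.
elim: n a f => [a f mf f0|n IHn a f mf f0].
  by apply: eq_integral => x _; rewrite (thinmx0 a) addr0.
rewrite [in RHS]ge0_integral_rVS//.
rewrite ge0_integral_rVS//; last first.
  apply: (measurableT_comp mf). exact: (measurable_rV_add a).
rewrite -[RHS](ge0_integral_translation (a ord0 ord0)); last 2 first.
- exact: measurable_integral_rV_cons.
- by move=> t; exact: integral_ge0.
apply: eq_integral => t _.
rewrite [in LHS](rV_consE a).
under eq_integral do rewrite rV_consD.
rewrite (IHn _ (fun v => f (rV_cons (t + a ord0 ord0)%R v)))//.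
exact: measurableT_comp (measurable_rV_cons_l _).
Qed.

(** Each coordinate contributes one factor [c^-1]: the first through the one-dimensional dilation,
    the others through the induction hypothesis. *)
Lemma ge0_integral_rV_dilation n (c : R) (f : 'rV[R]_n -> \bar R) : (0 < c)%R ->
  measurable_fun setT f -> (forall x, 0 <= f x) ->
  \int[L n]_x f (c *: x)%R = (c ^- n)%:E * \int[L n]_x f x.
Proof.
move=> c0; elim: n f => [f mf f0|n IHn f mf f0].
  rewrite expr0 invr1 mul1e; apply: eq_integral => x _.
  by rewrite (thinmx0 x) scaler0.
rewrite [in RHS]ge0_integral_rVS//.
rewrite ge0_integral_rVS//; last exact: (measurableT_comp mf (measurable_rV_scale c)).
have mF := measurable_integral_rV_cons mf f0.
rewrite exprS invfM EFinM -muleA [in RHS]muleCA -ge0_integral_dilation//; last first.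
  by move=> t; exact: integral_ge0.
rewrite -ge0_integralZl//; last 3 first.
- by apply: (measurableT_comp mF); exact: measurable_funM.
- by move=> *; exact: integral_ge0.
- by rewrite lee_fin invr_ge0 exprn_ge0// ltW.
apply: eq_integral => t _.
under eq_integral do rewrite rV_consZ.
rewrite (IHn (fun v => f (rV_cons (c * t)%R v)))//.
exact: measurableT_comp (measurable_rV_cons_l _).
Qed.

End lebesgue_rV_integral.

Lemma in_mkset_bool (T : Type) (P : T -> bool) x : (x \in [set y | P y]) = P x.
Proof. by apply/idP/idP; rewrite inE. Qed.

(** * The Euclidean norm and Borel measurability *)

Section enorm_lemmas.
Context {R : realType} {n : nat}.
Implicit Types x y : 'rV[R]_n.

Lemma enorm_ge0 x : 0 <= enorm x.
Proof. exact: sqrtr_ge0. Qed.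

Lemma enorm0 : enorm (0 : 'rV[R]_n) = 0.
Proof.
rewrite /enorm big1 ?sqrtr0// => i _; by rewrite mxE expr0n.
Qed.

Lemma enorm_eq0 x : enorm x = 0 -> x = 0.
Proof.
move=> /eqP; rewrite sqrtr_eq0 => le0.
have : \sum_(i < n) x ord0 i ^+ 2 == 0.
  by rewrite eq_le le0 sumr_ge0// => i _; exact: sqr_ge0.
rewrite psumr_eq0; last by move=> i _; exact: sqr_ge0.
move=> /allP x0; apply/rowP => i; rewrite mxE.
by have /implyP/(_ isT) := x0 i (mem_index_enum i); rewrite sqrf_eq0 => /eqP.
Qed.

Lemma enorm_gt0 x : (0 < enorm x) = (x != 0).
Proof.
apply/idP/idP => [|x0]; first by apply: contraTneq => ->; rewrite enorm0 ltxx.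
by rewrite lt0r enorm_ge0 andbT; apply: contra_neq x0; exact: enorm_eq0.
Qed.

Lemma enormZ (c : R) x : enorm (c *: x) = `|c| * enorm x.
Proof.
rewrite /enorm -[in RHS]sqrtr_sqr -sqrtrM ?sqr_ge0//; congr Num.sqrt.
by rewrite mulr_sumr; apply: eq_bigr => i _; rewrite mxE exprMn.
Qed.

Lemma le_coord_enorm x (i : 'I_n) : `|x ord0 i| <= enorm x.
Proof.
rewrite -sqrtr_sqr ler_sqrt ?sumr_ge0//; last by move=> *; exact: sqr_ge0.
by rewrite (bigD1 i)//= lerDl sumr_ge0// => *; exact: sqr_ge0.
Qed.

Lemma measurable_fun_rVD d (T : measurableType d) (f g : T -> 'rV[R]_n) :
  measurable_fun setT f -> measurable_fun setT g ->
  measurable_fun setT (fun z => f z + g z)%R.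
Proof.
move=> mf mg; apply: measurable_fun_rVP => i; under eq_fun do rewrite !mxE.
by apply: measurable_funD; apply: (measurableT_comp (measurable_coord i)).
Qed.

Lemma measurable_enorm : measurable_fun setT (@enorm R n).
Proof.
rewrite (_ : @enorm R n = (fun t : R => t `^ 2^-1) \o (fun x => \sum_(i < n) x ord0 i ^+ 2)).
  apply: measurableT_comp; first exact: measurable_powR.
  apply: measurable_sum => i; apply: measurable_funX; exact: measurable_coord.
apply/funext => x /=; rewrite powR12_sqrt// sumr_ge0// => *; exact: sqr_ge0.
Qed.

Lemma measurable_enorm_lt (r : R) : measurable [set x : 'rV[R]_n | enorm x < r].
Proof.
rewrite (_ : [set x | _] = setT `&` @enorm R n @^-1` `]-oo, r[); last first.
  by rewrite setTI; apply/seteqP; split => x /=; rewrite in_itv.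
exact: measurable_enorm.
Qed.

Lemma measurable_enorm_gt (r : R) : measurable [set x : 'rV[R]_n | r < enorm x].
Proof.
rewrite (_ : [set x | _] = setT `&` @enorm R n @^-1` `]r, +oo[); last first.
  by rewrite setTI; apply/seteqP; split => x /=; rewrite in_itv/= andbT.
exact: measurable_enorm.
Qed.

(** The sigma-algebra is generated by the coordinates, whereas openness refers to the sup norm. The
    link is that [U] is the countable union of the boxes with rational centre and radius
    [1 / (k + 1)] that it contains. *)
Lemma open_measurable_rV (U : set 'rV[R]_n) : open U -> measurable U.
Proof.
move=> oU.
pose box (q : 'rV[rat]_n) (k : nat) : set 'rV[R]_n :=
  [set x | forall i, `|x ord0 i - ratr (q ord0 i)| < k.+1%:R^-1].
have mbox q k : measurable (box q k).
  rewrite (_ : box q k = \bigcap_(i in [set: 'I_n]) ((fun x => x ord0 i) @^-1`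
      [set t | `|t - ratr (q ord0 i)| < k.+1%:R^-1])); last first.
    by apply/seteqP; split => x /= => [h i _|h i]; exact: h.
  apply: fin_bigcap_measurable => // i _.
  rewrite -[X in measurable X]setTI; apply: (measurable_coord i) => //.
  apply: open_measurable.
  rewrite [X in open X](_ : _ = ball (ratr (q ord0 i) : R) k.+1%:R^-1).
    exact: ball_open.
  by apply/seteqP; split => t; rewrite /ball /= distrC.
have -> : U = \bigcup_(z in [set: 'rV[rat]_n * nat])
    (if `[< box z.1 z.2 `<=` U >] then box z.1 z.2 else set0).
  apply/seteqP; split => [x Ux|x [z _]]; last first.
    by case: asboolP => [zU|_] // => /zU.
  have /nbhs_ballP[e /= e0 eU] : nbhs x U by exact: open_nbhs_nbhs.
  (* Half of [e], since [x] and any [y] of the box are each within [1 / (k + 1)] of the centre. *)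
  have [k ke] : exists k : nat, k.+1%:R^-1 < e / 2.
    have [k _ /(_ k (leqnn _)) h] := near_infty_natSinv_lt (PosNum (divr_gt0 e0 (@ltr0n R 2))).
    by exists k.
  have /boolp.choice[q xq] : forall i : 'I_n, exists r : rat,
      `|x ord0 i - ratr r| < k.+1%:R^-1.
    move=> i.
    have /rat_in_itvoo[q] : x ord0 i - k.+1%:R^-1 < x ord0 i + k.+1%:R^-1.
      by rewrite ltrBlDr -addrA ltrDl addr_gt0 ?invr_gt0.
    rewrite in_itv/= => /andP[q1 q2]; exists q.
    by rewrite ltr_norml ltrBrDr addrC -ltrBrDr opprK q2/= ltrBlDr -ltrBlDl q1.
  exists (\row_i q i, k) => //=.
  rewrite asboolT => [i|y yq]; first by rewrite mxE.
  apply: eU; split=> // i j; rewrite (ord1 i) /ball/=.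
  have := ler_distD (ratr (q j)) (x ord0 j) (y ord0 j).
  move=> /le_lt_trans; apply; have := yq j; rewrite mxE => yj.
  by rewrite [ltRHS](splitr e) ltrD// (lt_trans _ ke)// distrC.
apply: countable_bigcupT_measurable => // z.
by case: ifP => // _; exact: mbox.
Qed.

Lemma continuous_measurable_rV (f : 'rV[R]_n -> R) :
  continuous f -> measurable_fun setT f.
Proof.
move=> cf; apply: (measurability _ (RGenOInfty.measurableE R)) => //.
move=> _ [_ [a ->] <-]; rewrite setTI; apply: open_measurable_rV.
by apply: open_comp => //; exact: interval_open.
Qed.

End enorm_lemmas.

(** * Integration of radial functions *)

Section radial.
Context {R : realType}.
Local Open Scope ereal_scope.
Local Notation leb := (@lebesgue_measure R).

(** A kernel on the cone [0 < r < t]. It inserts an auxiliary scale [t] into an integral over [h],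
    with [r] the norm of [h], so that [h] can then be rescaled by [t]. *)
Definition cone_weight (n : nat) (r t : R) : R :=
  if ((0 < r) && (r < t))%R then (r ^+ n / t ^+ n.+1)%R else 0%R.

Lemma cone_weight_ge0 n r t : (0 <= cone_weight n r t)%R.
Proof.
rewrite /cone_weight; case: ifPn => // /andP[r0 rt].
by rewrite divr_ge0// exprn_ge0// ltW// (lt_trans r0).
Qed.

Lemma measurable_cone_weight n :
  measurable_fun setT (fun z : R * R => cone_weight n z.1 z.2).
Proof.
rewrite (_ : (fun _ => _) = (fun z : R * R => if ((0 < z.1) && (z.1 < z.2))%R
    then (z.1 ^+ n * z.2 `^ (- n.+1%:R))%R else 0%R)).
  apply: measurable_fun_ifT => //=.
    by apply: measurable_and; apply: measurable_fun_ltr.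
  apply: measurable_funM; first exact: measurable_funX.
  exact: (measurableT_comp (measurable_powR _)).
apply/funext => -[r t]; rewrite /cone_weight/=; case: ifPn => // /andP[r0 rt].
by rewrite powRN powR_mulrn// ltW// (lt_trans r0).
Qed.

Lemma integral_cone_weight n (r : R) : (0 < n)%N -> (0 < r)%R ->
  \int[leb]_t (cone_weight n r t)%:E = (n%:R^-1)%:E.
Proof.
move=> n0 r0.
have n00 : (n%:R : R) != 0%R by rewrite pnatr_eq0 -lt0n.
(* The primitive that vanishes at infinity. Its value at [r] is [- 1 / n], so [r] drops out of the
   integral. *)
pose F (t : R) : R := (- (r ^+ n / n%:R) * (t ^+ n)^-1)%R.
pose f (t : R) : R := (r ^+ n / t ^+ n.+1)%R.
have ctsX m (x : R) : {for x, continuous (fun t : R => t ^+ m)%R}.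
  exact: exprn_continuous.
have dF (x : R) : (0 < x)%R -> is_derive x (1%R : R) F (f x).
  move=> x0; have xn0 m : (x ^+ m != 0)%R by rewrite expf_neq0// gt_eqF.
  have dX : is_derive x (1%R : R) (fun t : R => t ^+ n)%R (n%:R * x ^+ n.-1)%R.
    by apply: DeriveDef; [exact: exprn_derivable|rewrite exp_derive /GRing.scale/= mulr1].
  have dV := @is_deriveV R (fun t : R => t ^+ n)%R x _ _ (xn0 n) dX.
  have dZ := @is_deriveZ _ _ _ _ (- (r ^+ n / n%:R))%R _ _ _ dV.
  suff -> : f x = (- (r ^+ n / n%:R) *: (- (x ^+ n) ^- 2 *: (n%:R * x ^+ n.-1)))%R.
    exact: dZ.
  rewrite /f /GRing.scale/=; case: n {F f dX dV dZ} n0 xn0 n00 => // m _ xn0 n00.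
  rewrite /= !exprS; field.
  by rewrite (xn0 m) gt_eqF//= addrC natr1 n00.
have cF (x : R) : (0 < x)%R -> {for x, continuous F}.
  move=> /dF[dFx _]; apply: differentiable_continuous.
  exact/derivable1_diffP.
have rp x : (r <= x)%R -> (0 < x)%R by exact: lt_le_trans.
transitivity (\int[leb]_(t in `]r, +oo[) (f t)%:E).
  rewrite [RHS]integral_mkcond; apply: eq_integral => t _.
  rewrite /cone_weight patchE mem_setE in_itv/= andbT r0/=.
  by case: ifPn.
rewrite integral_itv_obnd_cbnd; last first.
  apply: (eq_measurable_fun (fun t => (cone_weight n r t)%:E)) => [t|].
    by rewrite inE/= in_itv/= andbT /cone_weight r0/= => ->.
  apply/measurable_funTS/measurable_EFinP.
  exact: (measurableT_comp (measurable_cone_weight n) (measurable_pair1 r)).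
rewrite (@ge0_continuous_FTC2y R f F r 0).
- rewrite /F sub0e mulNr -EFinN opprK; congr EFin.
  by rewrite mulrAC mulfV ?mul1r// expf_neq0// gt_eqF.
- by move=> x rx; rewrite divr_ge0// exprn_ge0 ?(le_trans _ rx) ?ltW.
- apply: continuous_in_subspaceT => x; rewrite inE/= in_itv/= andbT => /rp x0.
  apply: cvgM; first exact: cvg_cst.
  apply: cvgV; [by rewrite expf_neq0// gt_eqF|exact: ctsX].
- rewrite -[0%R in X in _ --> X](mulr0 (- (r ^+ n / n%:R))%R).
  apply: cvgM; first exact: cvg_cst.
  apply/gtr0_cvgV0; first by near=> x; rewrite exprn_gt0.
  apply/cvgryPge => A; near=> x.
  have x1 : (1 <= x)%R by [].
  apply: (@le_trans _ _ x) => //.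
  by rewrite -[leLHS]expr1 ler_weXn2l.
- by move=> x rx; have /dF[] : (0 < x)%R by exact: lt_trans rx.
- by apply: cvg_at_right_filter; apply: cF.
- move=> x; rewrite in_itv/= andbT => rx.
  by rewrite derive1E; have /dF[_ ->] : (0 < x)%R by exact: lt_trans rx.
Unshelve. all: by end_near.
Qed.

(* The weight satisfies [cone_weight n (t * r) t = t^-1 * cone_weight n r 1], and its
   integral in [t] does not depend on [r]: this makes polar coordinates a
   consequence of Tonelli and of the homogeneity of Lebesgue measure. *)
Lemma ge0_integral_radial_le n (f : R -> \bar R) : (0 < n)%N ->
  measurable_fun [set: R] f -> (forall t, 0 <= f t) ->
  \int[lebesgue_rV n]_(h in [set h : 'rV[R]_n | (0 < enorm h)%R]) f (enorm h) <=
  n%:R%:E * lebesgue_rV n [set x : 'rV[R]_n | (enorm x < 1)%R] *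
    \int[leb]_(t in `]0%R, +oo[) (f t * (t ^+ n.-1)%:E).
Proof.
move=> n0 mf f0; set L := lebesgue_rV n; set I := \int[leb]_(t in _) _.
have n00 : (n%:R : R) != 0%R by rewrite pnatr_eq0 -lt0n.
have menorm := @measurable_enorm R n.
have mfe : measurable_fun setT (fun h : 'rV[R]_n => f (enorm h)).
  exact: measurableT_comp.
pose W (r t : R) := (cone_weight n r t)%:E.
have W0 r t : 0 <= W r t by rewrite lee_fin cone_weight_ge0.
have mW : measurable_fun setT (fun z : R * R => W z.1 z.2).
  by apply/measurable_EFinP; exact: measurable_cone_weight.
pose G (z : 'rV[R]_n * measurableTypeR R) := f (enorm z.1) * W (enorm z.1) z.2.
have mfst : measurable_fun setT (fun z : 'rV[R]_n * measurableTypeR R => enorm z.1).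
  exact: (measurableT_comp menorm).
have mG : measurable_fun setT G.
  apply: emeasurable_funM; first exact: measurableT_comp.
  apply: (measurableT_comp mW (g := fun z : 'rV[R]_n * measurableTypeR R => (enorm z.1, z.2))).
  by apply/measurable_fun_pairP; split; [exact: mfst|exact: measurable_snd].
have G0 z : 0 <= G z by rewrite mule_ge0.
(* Write 1 as [n * n^-1] and replace [n^-1] by the integral of the weight in [t]. *)
rewrite [leLHS](_ : _ = n%:R%:E * \int[L]_h \int[leb]_t G (h, t)); last first.
  transitivity (n%:R%:E * \int[L]_(h in [set h | (0 < enorm h)%R]) (n%:R^-1%:E * f (enorm h))).
    rewrite ge0_integralZl//.
    - by rewrite muleA -EFinM mulfV// mul1e.
    - exact: measurable_enorm_gt.
    - exact: measurable_funTS.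
  congr (_ * _).
  rewrite integral_mkcond; apply: eq_integral => h _.
  rewrite patchE (in_mkset_bool (fun h : 'rV[R]_n => 0 < enorm h)%R) /G /=; case: ifPn => h0; last first.
    by rewrite integral0_eq// => t _; rewrite /W /cone_weight (negbTE h0)/= mule0.
  rewrite ge0_integralZl//.
  - by rewrite integral_cone_weight// muleC.
  - exact: (measurableT_comp mW (measurable_pair1 (enorm h))).
rewrite -muleA lee_pmul2l//; last by rewrite lte_fin ltr0n.
rewrite (fubini_tonelli G)//.
pose psi (t : R) := if (0 < t)%R then f t * (t ^+ n.-1)%:E else 0.
have mpsi : measurable_fun setT psi.
  apply: measurable_fun_ifT => //; first exact: measurable_fun_ltr.
  apply: emeasurable_funM => //; apply/measurable_EFinP; exact: measurable_funX.
have psi0 t : 0 <= psi t.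
  by rewrite /psi; case: ifPn => // t0; rewrite mule_ge0// lee_fin exprn_ge0// ltW.
(* This is the integrand after the substitution [h = t *: k]. With [e = enorm k], the Jacobian and
   the weight give [t^n * (t e)^n / t^(n+1) = e * (t e)^(n-1)], so the integral in [t] is the same
   for every [k] with [0 < e < 1]. *)
pose H (z : 'rV[R]_n * measurableTypeR R) := if (0 < enorm z.1)%R && (enorm z.1 < 1)%R
  then (enorm z.1)%:E * psi (enorm z.1 * z.2)%R else 0.
have mH : measurable_fun setT H.
  apply: measurable_fun_ifT => //.
    by apply: measurable_and; apply: measurable_fun_ltr.
  apply: emeasurable_funM; first exact/measurable_EFinP.
  apply: (measurableT_comp mpsi); exact: measurable_funM.
have H0 z : 0 <= H z by rewrite /H; case: ifPn => // _; rewrite mule_ge0// lee_fin enorm_ge0.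
rewrite [leLHS](_ : _ = \int[leb]_t \int[L]_k H (k, t)); last first.
  apply: eq_integral => t _; have [t0|t0] := ltP 0%R t; last first.
    transitivity (0 : \bar R); [|apply/esym]; apply: integral0_eq => h _.
      rewrite /G /W /cone_weight/=; case: ifPn => [/andP[h0 ht]|_].
        by have := lt_trans h0 ht; rewrite ltNge t0.
      by rewrite mule0.
    rewrite /H /psi/=; case: ifPn => // /andP[h0 _].
    by rewrite ltNge mulr_ge0_le0 ?enorm_ge0//= mule0.
  have tn0 : (t ^+ n != 0)%R by apply: expf_neq0; exact: lt0r_neq0.
  have mGt : measurable_fun setT (fun h => G (h, t)).
    exact: (measurableT_comp mG (measurable_pair2 (t : measurableTypeR R))).
  transitivity ((t ^+ n)%:E * \int[L]_k G (t *: k, t)%R).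
    rewrite (ge0_integral_rV_dilation (f := fun h => G (h, t)) t0)//.
    by rewrite muleA -EFinM mulfV// mul1e.
  rewrite -ge0_integralZl//; last 2 first.
  - apply: (measurableT_comp mGt). exact: (measurable_rV_scale t).
  - by rewrite lee_fin exprn_ge0// ltW.
  apply: eq_integral => k _; rewrite /G /W /H/= /cone_weight /psi enormZ gtr0_norm//.
  have -> : (0 < t * enorm k < t)%R = (0 < enorm k < 1)%R.
    by rewrite pmulr_rgt0// -[X in (_ * _ < X)%R]mulr1 ltr_pM2l.
   case: ifPn => [/andP[k0 k1]|_]; last by rewrite !mule0.
  have -> : (0 < enorm k * t)%R by exact: mulr_gt0.
  rewrite muleCA [RHS]muleCA (mulrC (enorm k) t); congr (_ * _).
  rewrite -!EFinM; congr EFin.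
  set e := enorm k in k0 *; clearbody e; move: n0 tn0.
  case: (n) => // m _ tn0; rewrite /= !exprMn !exprS.
  have tm0 : (t ^+ m != 0)%R by rewrite expf_neq0// gt_eqF.
  by field; rewrite tm0 gt_eqF.
rewrite -(fubini_tonelli H)//.
(* The inequality enters here: at [k = 0] the left integrand is 0 and the right one is [I].
   Elsewhere in the ball the two agree. *)
apply: (@le_trans _ _ (\int[L]_(k in [set x | (enorm x < 1)%R]) I)).
  rewrite [leRHS]integral_mkcond; apply: ge0_le_integral => //.
  - by move=> *; exact: integral_ge0.
  - exact: (measurable_fun_fubini_tonelli_F _ mH H0).
  - apply: (measurable_restrictT _ _).1; first exact: measurable_enorm_lt.
    exact: measurable_cst.
  - move=> k _; rewrite patchE (in_mkset_bool (fun h : 'rV[R]_n => enorm h < 1)%R) /H/=.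
    case: (boolP ((0 < enorm k)%R && (enorm k < 1)%R)) => [/andP[k0 k1]|_].
      rewrite k1 ge0_integralZl//; last 2 first.
      + by apply: (measurableT_comp mpsi); exact: measurable_funM.
      + exact: enorm_ge0.
      rewrite ge0_integral_dilation// muleA -EFinM mulfV ?gt_eqF// mul1e.
      rewrite /I [leRHS]integral_mkcond le_eqVlt; apply/orP; left; apply/eqP.
      by apply: eq_integral => t _; rewrite patchE mem_setE in_itv/= andbT.
    rewrite integral0; case: ifPn => // _.
    by apply: integral_ge0 => t; rewrite /= in_itv/= andbT => t0; rewrite mule_ge0// lee_fin exprn_ge0// ltW.
rewrite integral_cst// 1?muleC//.
exact: measurable_enorm_lt.
Qed.
End radial.

(** * Directional derivatives, from partial derivatives to arbitrary directions *)

Section directional.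
Context {R : realType} {V : normedModType R}.
Implicit Types (v : V -> R) (a b x : V).

Lemma is_deriveP (W : normedModType R) (f : W -> R) (x a : W) (df : R) :
  is_derive x a f df <->
  (fun h : R => h^-1 *: ((f \o shift x) (h *: a) - f x)) @ 0^' --> df.
Proof.
split=> [[dv <-] //|fdf]; apply: DeriveDef; first by apply/cvg_ex; exists df.
exact: cvg_lim.
Qed.

Lemma is_derive_line v x a (t df : R) :
  is_derive (x + t *: a) a v df <->
  is_derive t (1 : R) (fun s => v (x + s *: a)) df.
Proof.
rewrite !is_deriveP.
suff -> : (fun h : R => h^-1 *: (((fun s => v (x + s *: a)) \o shift t) (h *: (1 : R)) - v (x + t *: a))) =
  (fun h : R => h^-1 *: ((v \o shift (x + t *: a)) (h *: a) - v (x + t *: a))) by [].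
apply/funext => h /=; congr (_ *: (v _ - _)).
by rewrite [_%:A]mulr1 scalerDl addrCA.
Qed.

Lemma is_derive_dirZ v x a (c df : R) :
  is_derive x a v df -> is_derive x (c *: a) v (c * df).
Proof.
move=> vdf; rewrite -[x]addr0 -(scale0r (c *: a)); apply/is_derive_line.
rewrite (_ : (fun s => _) = (fun s => v (x + s *: a)) \o ( *%R c)); last first.
  by apply/funext => s /=; rewrite scalerA mulrC.
have dc : is_derive (0 : R) (1 : R) ( *%R c) c.
  by have := is_deriveZ c (is_derive_id (0 : R) (1 : R)); rewrite [_%:A]mulr1.
have dl : is_derive (c * 0 : R) (1 : R) (fun s => v (x + s *: a)) df.
  by apply/is_derive_line; rewrite mulr0 scale0r addr0.
by rewrite mulrC; have := @is_derive1_comp _ (fun s => v (x + s *: a)) ( *%R c) 0 _ _ dl dc.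
Qed.

(* The increment along [b] is controlled by the mean value theorem, so the
   continuity of [db] alone is enough. *)
Lemma is_derive_dirD v a b (da db : V -> R) :
  (forall x, is_derive x a v (da x)) -> (forall x, is_derive x b v (db x)) ->
  continuous db -> forall x, is_derive x (a + b) v (da x + db x).
Proof.
move=> va vb cb x; apply/is_deriveP.
rewrite (_ : (fun h => _) = (fun h : R => h^-1 *: ((v \o shift x) (h *: a) - v x) +
   h^-1 *: (v (x + h *: a + h *: b) - v (x + h *: a)))); last first.
  apply/funext => h /=; rewrite -scalerDr; congr (_ *: _).
  rewrite (_ : h *: (a + b) + x = x + h *: a + h *: b).
    by rewrite (addrC (h *: a) x) [RHS]addrC subrKA.
  by rewrite scalerDr addrC addrA.
apply: cvgD; first exact/is_deriveP.
apply/cvgrPdist_le => e e0.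
have /cvgrPdist_le/(_ _ e0)/nbhs_normP[d /= d0 dP] := cb x.
near=> h.
have [y ym ->] : exists2 y, `|y - x| < d &
   h^-1 *: (v (x + h *: a + h *: b) - v (x + h *: a)) = db y.
  pose phi s := v (x + h *: a + s *: b).
  have dphi s : is_derive s (1 : R) phi (db (x + h *: a + s *: b)).
    exact/is_derive_line.
  have cphi (A : set R) : {within A, continuous phi}.
    apply: continuous_subspaceT => s; apply: differentiable_continuous.
    by apply/derivable1_diffP; case: (dphi s).
  have hn0 : h != 0 by near: h; exact: nbhs_dnbhs_neq.
  (* The displacement is at most [|h| * (|a| + |b| + 1)]; the added 1 keeps the divisor positive
     when [a] and [b] both vanish. *)
  have hd c : `|c| <= `|h| -> `|x + h *: a + c *: b - x| < d.
    move=> ch; rewrite addrAC (addrC x) addrK.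
    apply: (le_lt_trans (ler_normD _ _)); rewrite !normrZ.
    apply: (@le_lt_trans _ _ (`|h| * (`|a| + `|b| + 1))).
      by rewrite -addrA mulrDr lerD2l// mulrDr ler_wpDr// ler_wpM2r.
    rewrite -ltr_pdivlMr; last by rewrite ltr_wpDl// addr_ge0.
    near: h; apply: dnbhs0_lt; rewrite divr_gt0// ltr_wpDl// addr_ge0//.
  have pE : v (x + h *: a) = phi 0 by rewrite /phi scale0r addr0.
  rewrite pE -/(phi h).
  case: (ltgtP h 0) hn0 => // h0 hn0.
    have [c] := MVT h0 (fun s _ => dphi s) (cphi _).
    rewrite in_itv/= => /andP[hc c0] e1.
    exists (x + h *: a + c *: b); first by apply: hd; rewrite !ltr0_norm// lerN2 ltW.
    by rewrite -(opprB (phi 0)) e1 sub0r mulrN opprK /GRing.scale/= mulrCA mulVf ?mulr1// lt_eqF.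
  have [c] := MVT h0 (fun s _ => dphi s) (cphi _).
  rewrite in_itv/= => /andP[c0 hc] e1.
  exists (x + h *: a + c *: b); first by apply: hd; rewrite (gtr0_norm c0) (gtr0_norm h0) ltW.
  by rewrite e1 subr0 /GRing.scale/= mulrCA mulVf ?mulr1// gt_eqF.
by apply: dP; rewrite /= distrC.
Unshelve. all: by end_near.
Qed.

End directional.

Section smooth_lines.
Context {R : realType} {n : nat}.
Implicit Types (v : 'rV[R]_n -> R) (x h : 'rV[R]_n).

(** Induction over the expansion of [h] in the canonical basis. Continuity of the partial sum is
    carried along with the derivative, since [is_derive_dirD] asks for it at each addition. *)
Lemma smooth_is_derive v h x : smooth v ->
  is_derive x h v (\sum_(i < n) h ord0 i * partial i v x).
Proof.
move=> sv; rewrite {1}[h]row_sum_delta.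
suff [] : (forall x, is_derive x (\sum_(i < n) h ord0 i *: 'e_i) v
   ((\sum_(i < n) (fun y => h ord0 i * partial i v y)) x)) /\
   continuous (\sum_(i < n) (fun y => h ord0 i * partial i v y)).
  by move=> /(_ x) + _; rewrite fct_sumE.
elim/big_rec2 : _ => [|i g y _ [yg cg]].
  split=> [y|]; last exact: cst_continuous.
  apply/is_deriveP; rewrite (_ : (fun _ => _) = cst 0); last first.
    by apply/funext => s /=; rewrite scaler0 add0r subrr scaler0.
  exact: cvg_cst.
have ci : continuous (fun z => h ord0 i * partial i v z).
  move=> z; apply: (@continuousM _ _ (fun=> h ord0 i) (partial i v)).
    exact: cst_continuous.
  exact: (sv [:: i]).1.
split; last by move=> z; exact: (continuousD (ci z) (cg z)).
move=> z; apply: (is_derive_dirD (da := fun z => h ord0 i * partial i v z) (db := g)) => //.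
move=> t; apply: is_derive_dirZ; apply: derivableP.
exact: (sv [::]).2.
Qed.

End smooth_lines.

Lemma le_poweR2r (R : realType) (r : R) (x y : \bar R) :
  (0 <= r)%R -> (0 <= x)%E -> (x <= y)%E -> (x `^ r <= y `^ r)%E.
Proof.
move=> r0 x0 xy; apply: gt0_ler_poweR => //; rewrite in_itv/= leey andbT//.
exact: le_trans xy.
Qed.

(** * Increments along a segment *)

Section line_estimate.
Context {R : realType} {n : nat}.
Implicit Types (v : 'rV[R]_n -> R) (x h : 'rV[R]_n).

(** Coordinatewise weighted arithmetic-geometric mean, with weights [|b| / |a|] and [|a| / |b|]
    chosen so that each of the two sums equals [|a| |b|]. *)
Lemma cauchy_schwarz_enorm (a b : 'rV[R]_n) :
  `|\sum_(i < n) a ord0 i * b ord0 i| <= enorm a * enorm b.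
Proof.
have [->|a0] := eqVneq a 0.
  by rewrite enorm0 mul0r big1 ?normr0// => i _; rewrite mxE mul0r.
have [->|b0] := eqVneq b 0.
  by rewrite enorm0 mulr0 big1 ?normr0// => i _; rewrite mxE mulr0.
have {}a0 : 0 < enorm a by rewrite enorm_gt0.
have {}b0 : 0 < enorm b by rewrite enorm_gt0.
apply: (le_trans (ler_norm_sum _ _ _)).
have sqE (c : 'rV[R]_n) : enorm c ^+ 2 = \sum_(i < n) c ord0 i ^+ 2.
  by rewrite sqr_sqrtr// sumr_ge0// => *; exact: sqr_ge0.
have le2 (i : 'I_n) : `|a ord0 i * b ord0 i| <=
    (enorm b / enorm a * a ord0 i ^+ 2 + enorm a / enorm b * b ord0 i ^+ 2) / 2.
  rewrite normrM -(real_normK (num_real (a ord0 i))) -(real_normK (num_real (b ord0 i))).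
  set s := `|_|; set t := `|_|; set A := enorm a in a0 *; set B := enorm b in b0 *.
  rewrite -subr_ge0 (_ : _ - _ = (B * s - A * t) ^+ 2 / (2 * A * B)).
    by rewrite divr_ge0 ?sqr_ge0// !mulr_ge0// ltW.
  by field; rewrite !gt_eqF.
apply: (le_trans (ler_sum _ (fun i _ => le2 i))).
rewrite -mulr_suml big_split/= -!mulr_sumr -!sqE.
by rewrite le_eqVlt; apply/orP; left; apply/eqP; field; rewrite !gt_eqF.
Qed.

Lemma continuous_line x h : continuous (fun t : R => x + t *: h).
Proof.
move=> t; apply: (@continuousD _ _ _ (fun=> x) (fun t : R => t *: h)).
  exact: cst_continuous.
exact: scalel_continuous.
Qed.

Lemma measurable_line x h : measurable_fun setT (fun t : R => x + t *: h).
Proof.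
apply: measurable_fun_rVP => i; under eq_fun do rewrite !mxE.
by apply: measurable_funD => //; exact: measurable_funM.
Qed.

Lemma continuous_partial v i : smooth v -> continuous (partial i v).
Proof. by move=> sv; exact: (sv [:: i]).1. Qed.

Lemma measurable_smooth v : smooth v -> measurable_fun setT v.
Proof. by move=> sv; apply: continuous_measurable_rV; exact: (sv [::]).1. Qed.

Lemma measurable_enorm_grad v : smooth v ->
  measurable_fun setT (fun x => enorm (grad v x)).
Proof.
move=> sv; apply: (measurableT_comp measurable_enorm).
apply: measurable_fun_rVP => i; under eq_fun do rewrite mxE.
by apply: continuous_measurable_rV; exact: continuous_partial.
Qed.

Local Open Scope ereal_scope.
Local Notation leb := (@lebesgue_measure R).

(** Jensen's inequality on the unit interval, obtained from Hoelder against the indicator of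
    [[0, 1]], whose norm for the conjugate exponent is 1. *)
Lemma integral_01_le_poweR (p : R) (w : R -> R) : (1 < p)%R ->
  measurable_fun [set: R] w -> (forall t, 0 <= w t)%R ->
  (\int[leb]_(t in `[0%R, 1%R]) (w t)%:E) `^ p <=
  \int[leb]_(t in `[0%R, 1%R]) (w t `^ p)%:E.
Proof.
move=> p1 mw w0; have p0 : (0 < p)%R by exact: lt_trans p1.
pose q := (p / (p - 1))%R.
have q0 : (0 < q)%R by rewrite divr_gt0// subr_gt0.
have pq : (p^-1 + q^-1 = 1)%R by rewrite /q; field; rewrite subr_eq0 !gt_eqF.
pose one := (\1_(`[0%R, 1%R]%classic : set R) : R -> R).
pose f := (w \* one)%R.
have m1 : measurable_fun [set: R] one by exact: measurable_indic.
have mf : measurable_fun [set: R] f by exact: measurable_funM.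
have := @hoelder _ (measurableTypeR R) R leb f one p q mf m1 p0 q0 pq.
rewrite Lnorm1.
have fE t : f t = ((w \_ `[0%R, 1%R]) t)%R.
  by rewrite /f /= patchE /one indicE; case: ifPn; rewrite ?mulr1 ?mulr0.
have -> : \int[leb]_t `|(EFin \o (f \* one)%R) t| = \int[leb]_(t in `[0%R, 1%R]) (w t)%:E.
  rewrite [RHS]integral_mkcond; apply: eq_integral => t _.
  rewrite /= fE patchE restrict_EFin /= patchE /one indicE; case: ifPn => _.
    by rewrite mulr1 ger0_norm.
  by rewrite mul0r normr0.
have -> : 'N[leb]_q%:E[EFin \o one] = 1.
  rewrite unlock.
  rewrite (_ : (\int[leb]_x _) = \int[leb]_(x in `[0%R, 1%R]) cst 1 x); last first.
    rewrite [RHS]integral_mkcond; apply: eq_integral => t _.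
    rewrite /= patchE /one indicE; case: ifPn => _.
      by rewrite normr1 powR1.
    by rewrite normr0 powR0// gt_eqF.
  by rewrite integral_cst//= lebesgue_measure_itv/= lte01 mul1e oppr0 adde0 poweR1r.
rewrite mule1 => /(le_poweR2r (ltW p0))/le_trans; apply.
  by apply: integral_ge0 => t _; rewrite lee_fin.
rewrite poweR_Lnorm ?gt_eqF//.
rewrite [leRHS]integral_mkcond le_eqVlt; apply/orP; left; apply/eqP.
apply: eq_integral => t _.
rewrite /= fE restrict_EFin /= !patchE; case: ifPn => _.
  by rewrite ger0_norm.
by rewrite normr0 powR0// gt_eqF.
Qed.

(** The increment is the integral over [[0, 1]] of the scalar product of [h] with the gradient at
    [x + t *: h]. Cauchy-Schwarz extracts [|h|], and Jensen moves the power [p] inside. *)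
Lemma smooth_increment_le (p : R) v x h : (1 < p)%R -> smooth v ->
  (`|v (x + h) - v x| `^ p)%:E <= (enorm h `^ p)%:E *
    \int[leb]_(t in `[0%R, 1%R]) (enorm (grad v (x + t *: h)) `^ p)%:E.
Proof.
move=> p1 sv; have p0 : (0 < p)%R by exact: lt_trans p1.
pose w (t : R) := enorm (grad v (x + t *: h)).
have mw : measurable_fun setT w.
  exact: (measurableT_comp (measurable_enorm_grad sv) (measurable_line x h)).
pose g (t : R) := (\sum_(i < n) h ord0 i * partial i v (x + t *: h))%R.
have cg : continuous g.
  move=> t; apply: cvg_big => [|i _]; first exact: add_continuous.
  apply: cvgM; first exact: cvg_cst.
  apply: (continuous_comp (@continuous_line x h t)).
  exact: continuous_partial.
have dphi (t : R) : is_derive t (1%R : R) (fun s : R => v (x + s *: h)%R) (g t).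
  by apply: (is_derive_line v x h t (g t)).1; exact: smooth_is_derive.
have cphi : continuous (fun s : R => v (x + s *: h)%R).
  by move=> s; apply: differentiable_continuous; apply/derivable1_diffP; case: (dphi s).
have : \int[leb]_(t in `[0%R, 1%R]) (g t)%:E = (v (x + h))%:E - (v x)%:E.
  rewrite (@continuous_FTC2 R g (fun s => v (x + s *: h)%R) 0 1)//.
  - by rewrite scale1r scale0r addr0.
  - exact: continuous_subspaceT.
  - split.
    + by move=> t _; case: (dphi t).
    + by apply: cvg_at_right_filter; exact: cphi.
    + by apply: cvg_at_left_filter; exact: cphi.
  - by move=> t _; rewrite derive1E; case: (dphi t).
have mg : measurable_fun (`[0%R, 1%R]%classic : set R) g.
  by apply: measurable_funTS; exact: continuous_measurable_fun.
move=> e.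
have : `|(v (x + h) - v x)%:E| <= (enorm h)%:E * \int[leb]_(t in `[0%R, 1%R]) (w t)%:E.
  rewrite EFinB -e.
  apply: (le_trans (le_abse_integral _ _ _)) => //; first exact/measurable_EFinP.
  rewrite -ge0_integralZl//; last 3 first.
  - by apply/measurable_EFinP; exact: measurable_funTS.
  - by move=> t _; rewrite lee_fin enorm_ge0.
  - by rewrite lee_fin enorm_ge0.
  apply: ge0_le_integral => //.
  - by apply: measurableT_comp => //; exact/measurable_EFinP.
  - apply: emeasurable_funM; first exact: measurable_cst.
    by apply/measurable_EFinP; exact: measurable_funTS.
  - move=> t _; rewrite /= -EFinM lee_fin.
    have := cauchy_schwarz_enorm h (grad v (x + t *: h)).
    by under eq_bigr do rewrite mxE.
move=> /(le_poweR2r (ltW p0))/le_trans h1.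
rewrite -poweR_EFin; apply: h1; first exact: abse_ge0.
rewrite poweRM ?lee_fin ?enorm_ge0//; last first.
  by rewrite integral_ge0// => t _; rewrite lee_fin enorm_ge0.
rewrite poweR_EFin lee_wpmul2l// ?lee_fin ?powR_ge0//.
by apply: integral_01_le_poweR => // t; exact: enorm_ge0.
Qed.

End line_estimate.

(** * Increments in L^p and the K-functional *)

Section fractional.
Context {R : realType} {n : nat}.
Implicit Types (u v : 'rV[R]_n -> R) (x h : 'rV[R]_n) (p s t : R).
Local Open Scope ereal_scope.
Local Notation leb := (@lebesgue_measure R).
Local Notation L := (@lebesgue_rV R n).

Lemma measurable_powR_norm p u : measurable_fun setT u ->
  measurable_fun setT (fun x => (`|u x| `^ p)%R%:E).
Proof.
move=> mu; apply/measurable_EFinP; apply: (measurableT_comp (measurable_powR p)).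
exact: measurableT_comp.
Qed.

(** After Tonelli, translation invariance makes the integral in [x] the same for every [t] in
    [[0, 1]], so averaging over the segment costs nothing. *)
Lemma integral_increment_le p v h : (1 < p)%R -> smooth v ->
  \int[L]_x (`|v (x + h) - v x| `^ p)%R%:E <=
  (enorm h `^ p)%:E * \int[L]_x (enorm (grad v x) `^ p)%:E.
Proof.
move=> p1 sv.
pose G (x : 'rV[R]_n) := (enorm (grad v x) `^ p)%:E.
have mG : measurable_fun setT G.
  apply/measurable_EFinP; apply: (measurableT_comp (measurable_powR p)).
  exact: measurable_enorm_grad.
have G0 x : 0 <= G x by rewrite lee_fin powR_ge0.
(* The segment integrand extended by 0 to all [t], so that Tonelli applies on the full product. *)
pose H (z : 'rV[R]_n * measurableTypeR R) :=
  (if (0 <= z.2 <= 1)%R then G (z.1 + z.2 *: h)%R else 0).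
have mH : measurable_fun setT H.
  apply: measurable_fun_ifT; last exact: measurable_cst.
    by apply: measurable_and; apply: measurable_fun_ler.
  apply: (measurableT_comp mG); apply: measurable_fun_rVD.
    exact: measurable_fst.
  apply: measurable_fun_rVP => i; under eq_fun do rewrite mxE.
  by apply: measurable_funM.
have H0 z : 0 <= H z by rewrite /H; case: ifPn.
have HE x : \int[leb]_(t in `[0%R, 1%R]) (enorm (grad v (x + t *: h)) `^ p)%:E =
    \int[leb]_t H (x, t).
  by rewrite integral_mkcond; apply: eq_integral => t _; rewrite patchE mem_setE in_itv.
apply: (@le_trans _ _ (\int[L]_x ((enorm h `^ p)%:E * \int[leb]_t H (x, t)))).
  apply: ge0_le_integral => //.
  - apply: measurable_powR_norm; apply: measurable_funB; last exact: measurable_smooth.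
    exact: (measurableT_comp (measurable_smooth sv) (measurable_rV_add h)).
  - apply: emeasurable_funM; first exact: measurable_cst.
    exact: (measurable_fun_fubini_tonelli_F _ mH H0).
  - by move=> x _; rewrite -HE; exact: smooth_increment_le.
rewrite ge0_integralZl//; last 3 first.
- exact: (measurable_fun_fubini_tonelli_F _ mH H0).
- by move=> x _; exact: integral_ge0.
- by rewrite lee_fin powR_ge0.
rewrite (fubini_tonelli H)// lee_wpmul2l ?lee_fin ?powR_ge0//.
rewrite (_ : \int[leb]_t _ = \int[leb]_(t in `[0%R, 1%R]) (cst (\int[L]_x G x) t)).
  by rewrite integral_cst//= lebesgue_measure_itv/= lte_fin ltr01 oppr0 adde0 mule1.
rewrite [RHS]integral_mkcond; apply: eq_integral => t _.
rewrite patchE mem_setE in_itv /H/=; case: ifPn => _; last by rewrite integral0.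
exact: ge0_integral_rV_translation.
Qed.

Lemma Cc_infty_eq0 Omega v x : Cc_infty Omega v -> ~ Omega x -> v x = 0%R.
Proof.
move=> [_ _ vO] nOx; apply/eqP/negPn/negP => vx; apply: nOx; apply: vO.
exact: subset_closure.
Qed.

(** Outside [Omega] the point avoids the closed support, so [v] vanishes on a whole neighbourhood
    and not merely at the point. *)
Lemma Cc_infty_grad_eq0 Omega v x : Cc_infty Omega v -> ~ Omega x -> grad v x = 0%R.
Proof.
move=> [_ _ vO] nOx; apply/rowP => i; rewrite !mxE /partial.
have : ~ tsupp v x by move=> /vO.
move=> nx; have oC : open (~` tsupp v) by exact/closed_openC/closed_closure.
have {}oC : nbhs x (~` tsupp v) by exact: open_nbhs_nbhs.
have e0 : \forall y \near x, v y = 0%R.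
  near=> y; apply/eqP/negPn/negP => vy.
  have : (~` tsupp v) y by near: y.
  by apply; exact: subset_closure.
have vx : v x = 0%R by exact: nbhs_singleton e0.
rewrite -(derive_cst (0%R : R) x ('e_i : 'rV[R]_n)).
apply: near_eq_derive => //.
Unshelve. all: by end_near.
Qed.

(** Passes from norms over [Omega], in which the K-functional is stated, to norms over the whole
    space, where translations act. *)
Lemma Lp_norm_supp p Omega (f : 'rV[R]_n -> R) : (forall x, ~ Omega x -> f x = 0%R) ->
  Lp_norm p Omega f = Lnorm L p%:E (EFin \o f).
Proof.
move=> f0; rewrite /Lp_norm; congr Lnorm; apply/funext => x /=; congr EFin.
rewrite patchE; case: ifPn => //; rewrite notin_setE => /f0 ->//.
Qed.

Lemma LnormE p (f : 'rV[R]_n -> R) :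
  Lnorm L p%:E (EFin \o f) = (\int[L]_x (`|f x| `^ p)%R%:E) `^ p^-1.
Proof. by rewrite Lnorm.unlock. Qed.

Lemma Lnorm_translation p (f : 'rV[R]_n -> R) h : measurable_fun setT f ->
  Lnorm L p%:E (EFin \o (fun x => f (x + h)%R)) = Lnorm L p%:E (EFin \o f).
Proof.
move=> mf; rewrite !LnormE.
pose F x := (`|f x| `^ p)%R%:E.
have F0 x : 0 <= F x by rewrite lee_fin powR_ge0.
by have /= -> := @ge0_integral_rV_translation R n h F (measurable_powR_norm p mf) F0.
Qed.

Lemma Lnorm_increment_grad p v h : (1 < p)%R -> smooth v ->
  Lnorm L p%:E (EFin \o (fun x => v (x + h) - v x)%R) <=
  (enorm h)%:E * Lnorm L p%:E (EFin \o (fun x => enorm (grad v x))).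
Proof.
move=> p1 sv; have p0 : (0 < p)%R by exact: lt_trans p1.
have pn0 : p != 0%R by rewrite gt_eqF.
have := integral_increment_le h p1 sv.
have -> : \int[L]_x (enorm (grad v x) `^ p)%:E = \int[L]_x (`|enorm (grad v x)| `^ p)%:E.
  by apply: eq_integral => x _; rewrite ger0_norm// enorm_ge0.
rewrite !LnormE.
set A := \int[L]_x (`|v (x + h) - v x| `^ p)%R%:E; set B := (\int[L]_x (`|enorm (grad v x)| `^ p)%:E).
have A0 : 0 <= A by apply: integral_ge0 => x _; rewrite lee_fin powR_ge0.
have B0 : 0 <= B by apply: integral_ge0 => x _; rewrite lee_fin powR_ge0.
move: A B A0 B0 => A B A0 B0 AB.
have pV : (0 <= p^-1)%R by rewrite invr_ge0 ltW.
apply: (le_trans (le_poweR2r pV A0 AB)).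
by rewrite poweRM ?lee_fin ?powR_ge0// poweR_EFin -powRrM mulfV// powRr1 ?enorm_ge0.
Qed.

Lemma Lnorm_increment_le p u v h : (1 < p)%R -> smooth u -> smooth v ->
  Lnorm L p%:E (EFin \o (fun x => u (x + h) - u x)%R) <=
  2%:E * (Lnorm L p%:E (EFin \o (u \- v)%R) +
    (enorm h / 2)%:E * Lnorm L p%:E (EFin \o (fun x => enorm (grad v x)))).
Proof.
move=> p1 su sv; have mu := measurable_smooth su; have mv := measurable_smooth sv.
have mw : measurable_fun setT (u \- v)%R by exact: measurable_funB.
have mwh : measurable_fun setT (fun x => (u \- v) (x + h))%R.
  exact: (measurableT_comp mw (measurable_rV_add h)).
have mvh : measurable_fun setT (fun x => v (x + h) - v x)%R.
  apply: measurable_funB => //.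
  exact: (measurableT_comp mv (measurable_rV_add h)).
(* With [w = u - v], the increment of [u] is [w(. + h) + (v(. + h) - v) - w]. The two terms in [w]
   have equal norm, and factoring out the resulting 2 halves [enorm h]. *)
have e : (fun x => u (x + h) - u x)%R =
    ((fun x => (u \- v) (x + h)) \+ ((fun x => v (x + h) - v x) \+ (\- (u \- v))))%R.
  by apply/funext => x /=; ring.
rewrite e.
apply: (le_trans (minkowski_EFin _ _ _ (ltW p1))) => //.
  by apply: measurable_funD => //; exact: measurableT_comp.
rewrite Lnorm_translation//.
apply: (@le_trans _ _ (Lnorm L p%:E (EFin \o (u \- v)%R) +
   (Lnorm L p%:E (EFin \o (fun x => v (x + h) - v x)%R) + Lnorm L p%:E (EFin \o (u \- v)%R)))).
  rewrite leeD2l//.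
  apply: (le_trans (minkowski_EFin _ _ _ (ltW p1))) => //.
    exact: measurableT_comp.
  rewrite leeD2l//.
  have := oppe_Lnorm L (EFin \o (u \- v)%R) p%:E.
  by rewrite (_ : (\- _) = EFin \o (\- (u \- v))%R) // => ->.
rewrite ge0_muleDr ?mule_ge0 ?Lnorm_ge0 ?lee_fin ?divr_ge0 ?enorm_ge0//.
rewrite muleA -EFinM mulrCA mulfV ?mulr1//.
rewrite addeCA addeC [X in _ <= X + _]mule_natl mule2n leeD2l//.
exact: Lnorm_increment_grad.
Qed.

Lemma Lnorm_increment_K p Omega u h : (1 < p)%R -> Cc_infty Omega u ->
  Lnorm L p%:E (EFin \o (fun x => u (x + h) - u x)%R) <=
  2%:E * K_functional p Omega (enorm h / 2) u.
Proof.
move=> p1 uC; rewrite -lee_pdivrMl//.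
apply: le_ereal_inf_tmp => _ [v vC <-].
rewrite lee_pdivrMl// [X in X + _]Lp_norm_supp; last first.
  by move=> x Ox /=; rewrite (Cc_infty_eq0 uC)// (Cc_infty_eq0 vC)// subrr.
rewrite Lp_norm_supp; last first.
  by move=> x Ox /=; rewrite (Cc_infty_grad_eq0 vC)// enorm0.
apply: Lnorm_increment_le => //; [by case: uC|by case: vC].
Qed.
End fractional.

(** * Comparison of the two seminorms *)

Section seminorm_comparison.
Context {R : realType} {n : nat}.
Implicit Types (u v : 'rV[R]_n -> R) (x h : 'rV[R]_n) (p s t : R).
Local Open Scope ereal_scope.
Local Notation leb := (@lebesgue_measure R).
Local Notation L := (@lebesgue_rV R n).

Lemma K_functional_ge0 p Omega t u : (0 <= t)%R -> 0 <= K_functional p Omega t u.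
Proof.
move=> t0; apply: le_ereal_inf_tmp => _ [v _ <-].
by rewrite adde_ge0 ?mule_ge0 ?Lnorm_ge0 ?lee_fin.
Qed.

Lemma le_K_functional p Omega u t t' : (t <= t')%R ->
  K_functional p Omega t u <= K_functional p Omega t' u.
Proof.
move=> tt'; apply: le_ereal_inf_tmp => _ [v vC <-].
apply: ge_ereal_inf; exists (Lp_norm p Omega (u \- v)%R +
  t%:E * Lp_norm p Omega (fun x => enorm (grad v x))); first by exists v.
by rewrite leeD2l// lee_wpmul2r ?Lnorm_ge0.
Qed.

(** Preimages of upper rays are intervals. Together with [le_K_functional] this makes the
    K-functional measurable in [t], although it is an infimum over an uncountable family. *)
Lemma ge0_nondecreasing_measurable (f : R -> \bar R) :
  {homo f : x y / (x <= y)%R >-> x <= y} -> measurable_fun [set: R] f.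
Proof.
move=> ndf; apply: (measurability _ (ErealGenOInfty.measurableE R)) => //.
move=> _ [_ [a ->] <-]; rewrite setTI.
apply: is_interval_measurable => x y /= fx fy z /andP[xz zy].
by move: fx; rewrite /= !in_itv/= !andbT => /lt_le_trans; apply; exact: ndf.
Qed.

Lemma measurable_integral_increment p u : measurable_fun setT u ->
  measurable_fun setT (fun h => \int[L]_x (`|u (x + h) - u x| `^ p)%R%:E).
Proof.
move=> mu.
pose H (z : 'rV[R]_n * 'rV[R]_n) := (`|u (z.2 + z.1) - u z.2| `^ p)%R%:E.
have mH : measurable_fun setT H.
  apply/measurable_EFinP; apply: (measurableT_comp (measurable_powR p)).
  apply: measurableT_comp => //; apply: measurable_funB.
    apply: (measurableT_comp mu); apply: measurable_fun_rVD.
      exact: measurable_snd.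
    exact: measurable_fst.
  exact: (measurableT_comp mu measurable_snd).
by apply: (measurable_fun_fubini_tonelli_F _ mH) => z; rewrite lee_fin powR_ge0.
Qed.

Lemma measurable_enorm_powRV (r : R) :
  measurable_fun setT (fun h : 'rV[R]_n => (enorm h `^ r)^-1%:E).
Proof.
apply/measurable_EFinP; under eq_fun do rewrite -powRN.
exact: (measurableT_comp (measurable_powR _) measurable_enorm).
Qed.

(** For fixed [y], substitute [x = h + y] by translation invariance; then exchange the integrals,
    which frees the kernel from the inner one. *)
Lemma D_norm_poweR s p u : (0 < p)%R -> smooth u ->
  D_norm s p u `^ p =
  \int[L]_h ((enorm h `^ (n%:R + s * p))^-1%:E * \int[L]_x (`|u (x + h) - u x| `^ p)%R%:E).
Proof.
move=> p0 su; have mu := measurable_smooth su.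
pose F (z : 'rV[R]_n * 'rV[R]_n) :=
  ((`|u z.1 - u z.2| `^ p) / (enorm (z.1 - z.2) `^ (n%:R + s * p)))%R%:E.
have F0 z : 0 <= F z by rewrite lee_fin divr_ge0// powR_ge0.
have msub : measurable_fun setT (fun z : 'rV[R]_n * 'rV[R]_n => z.1 - z.2)%R.
  apply: measurable_fun_rVP => i; under eq_fun do rewrite !mxE.
  apply: measurable_funB.
    exact: (measurableT_comp (measurable_coord i) measurable_fst).
  exact: (measurableT_comp (measurable_coord i) measurable_snd).
have mF : measurable_fun setT F.
  apply/measurable_EFinP; apply: measurable_funM.
    apply: (measurableT_comp (measurable_powR p)); apply: measurableT_comp => //.
    apply: measurable_funB.
      exact: (measurableT_comp mu measurable_fst).
    exact: (measurableT_comp mu measurable_snd).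
  rewrite (_ : (fun _ => _) = (fun z : 'rV[R]_n * 'rV[R]_n => enorm (z.1 - z.2) `^ (- (n%:R + s * p)))%R); last first.
    by apply/funext => z; rewrite powRN.
  apply: (measurableT_comp (measurable_powR _)).
  exact: (measurableT_comp measurable_enorm msub).
rewrite /D_norm -poweRrM mulVf ?gt_eqF// poweRe1; last by apply: integral_ge0 => z _; exact: F0.
rewrite -/F fubini_tonelli2//.
pose G (z : 'rV[R]_n * 'rV[R]_n) := F (z.1 + z.2, z.2)%R.
have mG : measurable_fun setT G.
  apply: (measurableT_comp mF); apply/measurable_fun_pairP; split; last exact: measurable_snd.
  by apply: measurable_fun_rVD; [exact: measurable_fst|exact: measurable_snd].
transitivity (\int[L]_y \int[L]_h G (h, y)).
  apply: eq_integral => y _.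
  have mFy : measurable_fun setT (fun x => F (x, y)).
    exact: (measurableT_comp mF (measurable_pair2 y)).
  exact/esym/(ge0_integral_rV_translation y mFy (fun x => F0 (x, y))).
have G0 z : 0 <= G z by exact: F0.
rewrite -(fubini_tonelli G mG G0).
apply: eq_integral => h _.
have mI : measurable_fun setT (fun x => (`|u (x + h) - u x| `^ p)%R%:E).
  apply: measurable_powR_norm; apply: measurable_funB => //.
  exact: (measurableT_comp mu (measurable_rV_add h)).
rewrite -ge0_integralZl; [|exact: measurableT|exact: mI|..].
- by apply: eq_integral => x _; rewrite /G /F /= addrK -EFinM mulrC (addrC h).
- by move=> x _; rewrite lee_fin powR_ge0.
- by rewrite lee_fin invr_ge0 powR_ge0.
Qed.

Lemma D_norm_le_X_norm s p Omega u : (0 < n)%N -> (1 < p)%R -> (0 < s < 1)%R ->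
  Cc_infty Omega u ->
  D_norm s p u `^ p <= (2 `^ (p * (1 - s)) * n%:R)%:E *
    L [set x : 'rV[R]_n | (enorm x < 1)%R] * X_norm s p Omega u `^ p.
Proof.
move=> n0 p1 /andP[s0 s1] uC; have p0 : (0 < p)%R by exact: lt_trans p1.
have su : smooth u by case: uC.
have mu := measurable_smooth su.
rewrite D_norm_poweR//.
(* The value 0 for [t <= 0] makes [K] nonnegative and nondecreasing on the whole line, hence
   measurable. *)
pose K t := if (0 < t)%R then K_functional p Omega t u else 0.
have K0 t : 0 <= K t by rewrite /K; case: ifPn => // t0; rewrite K_functional_ge0 ?ltW.
have mK : measurable_fun [set: R] K.
  apply: ge0_nondecreasing_measurable => t t' tt'; rewrite {1}/K; case: ifPn => [t0|_ //].
  by rewrite /K (lt_le_trans t0 tt') le_K_functional.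
pose psi t := if (0 < t)%R then K t `^ p * (t `^ (- (s * p) - 1))%:E else 0.
have mKp : measurable_fun [set: R] (fun t => K t `^ p).
  exact: (measurableT_comp (measurable_poweR p)).
have mpsi : measurable_fun [set: R] psi.
  apply: measurable_fun_ifT; [exact: measurable_fun_ltr| |exact: measurable_cst].
  by apply: emeasurable_funM => //; apply/measurable_EFinP; exact: measurable_powR.
have psi0 t : 0 <= psi t.
  by rewrite /psi; case: ifPn => // _; rewrite mule_ge0 ?poweR_ge0// lee_fin powR_ge0.
have XE : X_norm s p Omega u `^ p = \int[leb]_t psi t.
  rewrite /X_norm -poweRrM mulVf ?gt_eqF// poweRe1; last first.
    apply: integral_ge0 => t; rewrite /= in_itv/= andbT => t0.
    by rewrite mule_ge0 ?poweR_ge0// lee_fin invr_ge0 ltW.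
  rewrite integral_mkcond; apply: eq_integral => t _.
  rewrite patchE mem_setE in_itv/= andbT /psi /K; case: ifPn => // t0.
  rewrite poweRM ?K_functional_ge0 ?(ltW t0)// ?lee_fin ?invr_ge0 ?powR_ge0//.
  rewrite -muleA; congr (_ * _); rewrite poweR_EFin -EFinM; congr EFin.
  rewrite -powRN -powRrM mulNr powRD; last by apply/implyP => _; rewrite gt_eqF.
  by rewrite powR_inv1 ?ltW.
(* The radial majorant: at [t = enorm h] it bounds the kernel times the p-th power of the increment
   norm. *)
pose f t := if (0 < t)%R then (t `^ (- (n%:R + s * p)))%:E * (2%:E * K (t / 2)%R) `^ p else 0.
have mf : measurable_fun [set: R] f.
  apply: measurable_fun_ifT; [exact: measurable_fun_ltr| |exact: measurable_cst].
  apply: emeasurable_funM; first by apply/measurable_EFinP; exact: measurable_powR.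
  apply: (measurableT_comp (measurable_poweR p)).
  apply: emeasurable_funM; first exact: measurable_cst.
  by apply: (measurableT_comp mK); exact: measurable_funM.
have f0 t : 0 <= f t.
  by rewrite /f; case: ifPn => // _; rewrite mule_ge0 ?poweR_ge0// lee_fin powR_ge0.
apply: (@le_trans _ _ (\int[L]_(h in [set h : 'rV[R]_n | (0 < enorm h)%R]) f (enorm h))).
  rewrite [leRHS]integral_mkcond.
  apply: ge0_le_integral => //.
  - move=> h _; rewrite mule_ge0 ?lee_fin ?invr_ge0 ?powR_ge0//.
    by apply: integral_ge0 => x _; rewrite lee_fin powR_ge0.
  - apply: emeasurable_funM; first exact: measurable_enorm_powRV.
    exact: measurable_integral_increment.
  - apply: (measurable_restrictT _ _).1; first exact: measurable_enorm_gt.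
    by apply: measurable_funTS; exact: (measurableT_comp mf measurable_enorm).
  move=> h _; rewrite patchE (in_mkset_bool (fun h : 'rV[R]_n => 0 < enorm h)%R).
  have np0 : (n%:R + s * p != 0)%R by rewrite gt_eqF// ltr_wpDl// mulr_gt0.
  case: ifPn => [h0|]; last first.
    rewrite -leNgt => h0; have -> : enorm h = 0%R by apply/eqP; rewrite eq_le h0 enorm_ge0.
    by rewrite powR0// invr0 mul0e.
  rewrite /f h0 powRN lee_wpmul2l ?lee_fin ?invr_ge0 ?powR_ge0//.
  rewrite /K divr_gt0//.
  rewrite -[leLHS](_ : Lnorm L p%:E (EFin \o (fun x => u (x + h) - u x)%R) `^ p = _).
    by apply: le_poweR2r; [exact: ltW|exact: Lnorm_ge0|exact: Lnorm_increment_K].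
  by rewrite poweR_Lnorm// gt_eqF.
apply: (le_trans (ge0_integral_radial_le n0 mf f0)).
rewrite XE (mulrC _ n%:R) EFinM -!muleA lee_wpmul2l// muleCA lee_wpmul2l//.
(* The polar factor [t^(n-1)] turns [t^(-n - s p)] into [t^(- s p - 1)]. Evaluating [psi] at [t / 2]
   absorbs [2^(s p + 1)] out of [2^p]; the dilation below returns one factor 2. *)
apply: (@le_trans _ _ (\int[leb]_t ((2 `^ (p * (1 - s) - 1))%:E * psi (2^-1 * t)%R))).
  rewrite integral_mkcond le_eqVlt; apply/orP; left; apply/eqP.
  apply: eq_integral => t _; rewrite patchE mem_setE in_itv/= andbT /f /psi.
  rewrite pmulr_rgt0//; case: ifPn => t0; last by rewrite mule0.
  rewrite /K (mulrC t) pmulr_rgt0// t0 poweRM ?K_functional_ge0 ?mulr_ge0 ?(ltW t0)//.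
  rewrite [2%:E `^ p * _]muleC [X in X * _ = _]muleCA -muleA [RHS]muleCA; congr (_ * _).
  rewrite poweR_EFin -!EFinM; congr EFin.
  have tp r r' : (t `^ (r + r') = t `^ r * t `^ r')%R.
    by rewrite powRD//; apply/implyP => _; rewrite gt_eqF.
  have twop r r' : (2 `^ (r + r') = 2 `^ r * 2 `^ r' :> R)%R.
    by rewrite powRD//; apply/implyP => _; rewrite pnatr_eq0.
  rewrite -powR_mulrn ?(ltW t0)// powRM ?invr_ge0 ?(ltW t0)//.
  rewrite -powR_inv1// -powRrM mulrAC -tp mulrCA mulrA -twop mulrC.
  congr (2 `^ _ * t `^ _)%R; first by ring.
  by rewrite -[in LHS](prednK n0) -natr1; ring.
have mpsi2 : measurable_fun [set: R] (fun t => psi (2^-1 * t)%R).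
  by apply: (measurableT_comp mpsi); exact: measurable_funM.
have c0 : 0 <= (2 `^ (p * (1 - s) - 1))%:E by rewrite lee_fin powR_ge0.
rewrite ge0_integralZl; [|exact: measurableT|exact: mpsi2|by move=> t _; exact: psi0|exact: c0].
rewrite ge0_integral_dilation// invrK muleA -EFinM.
rewrite powRD ?pnatr_eq0//.
by rewrite powR_inv1// mulfVK.
by rewrite implybT.
Qed.

End seminorm_comparison.

(** * Linearity of the test space and finiteness of the unit ball *)

Section test_function_space.
Context {R : realType} {n : nat}.
Implicit Types (u v : 'rV[R]_n -> R) (a : R).

Lemma iter_partial_lin a u v l : smooth u -> smooth v ->
  iter_partial l (fun x => a * u x + v x) =
  (fun x => a * iter_partial l u x + iter_partial l v x).
Proof.
move=> su sv; elim: l => [//|i l IH]; rewrite /= IH; apply/funext => x.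
have du : is_derive x 'e_i (iter_partial l u) (partial i (iter_partial l u) x).
  by apply: derivableP; exact: (su l).2.
have dv : is_derive x 'e_i (iter_partial l v) (partial i (iter_partial l v) x).
  by apply: derivableP; exact: (sv l).2.
by have [_ e] := is_deriveD (is_deriveZ a du) dv; exact: e.
Qed.

Lemma smooth_lin a u v : smooth u -> smooth v -> smooth (fun x => a * u x + v x).
Proof.
move=> su sv l; rewrite iter_partial_lin//; split=> [x|i x].
  apply: (@continuousD _ _ _ (fun x => a * iter_partial l u x) (iter_partial l v)).
    apply: (@continuousM _ _ (fun=> a) (iter_partial l u)); first exact: cst_continuous.
    exact: (su l).1.
  exact: (sv l).1.
have du : is_derive x 'e_i (iter_partial l u) (partial i (iter_partial l u) x).
  by apply: derivableP; exact: (su l).2.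
have dv : is_derive x 'e_i (iter_partial l v) (partial i (iter_partial l v) x).
  by apply: derivableP; exact: (sv l).2.
by have [] := is_deriveD (is_deriveZ a du) dv.
Qed.

Lemma Cc_infty_lin Omega a u v : Cc_infty Omega u -> Cc_infty Omega v ->
  Cc_infty Omega (fun x => a * u x + v x).
Proof.
move=> [su cu uO] [sv cv vO].
have sub : tsupp (fun x => a * u x + v x) `<=` tsupp u `|` tsupp v.
  rewrite -closureU; apply: closure_subset => x /= uv0.
  have [u0|] := eqVneq (u x) 0; last by left.
  by right; apply: contra_neq uv0; rewrite u0 mulr0 add0r.
split; [exact: smooth_lin| |by apply: (subset_trans sub); rewrite subUset].
apply: (subclosed_compact _ _ sub); first exact: closed_closure.
exact: compactU.
Qed.

(** The ball lies in the cube []-1, 1[^n]. Finiteness lets the real number [unit_ball_volume] stand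
    for the measure. *)
Lemma unit_ball_finite : (lebesgue_rV n [set x : 'rV[R]_n | (enorm x < 1)%R] < +oo)%E.
Proof.
pose A (i : 'I_n) : set (measurableTypeR R) := `]-1, 1[%classic.
apply: (@le_lt_trans _ _ (lebesgue_rV n [set x : 'rV[R]_n | forall i, A i (x ord0 i)])).
  apply: le_measure.
  - by rewrite inE; exact: measurable_enorm_lt.
  - rewrite inE (_ : [set x | _] = \bigcap_(i in [set: 'I_n]) ((fun x : 'rV[R]_n => x ord0 i) @^-1` A i)); last first.
      by apply/seteqP; split => x /= => [h i _|h i]; exact: h.
    apply: fin_bigcap_measurable => // i _.
    rewrite -[X in measurable X]setTI; apply: (measurable_coord i) => //.
    exact: measurable_itv.
  - move=> x /= x1 i; rewrite /A /= in_itv/= -ltr_norml.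
    exact: le_lt_trans (le_coord_enorm x i) x1.
rewrite lebesgue_rV_box; last by move=> i; exact: measurable_itv.
have Afin i : (0 <= lebesgue_measure (A i) < +oo)%E.
  by rewrite measure_ge0/= lebesgue_measure_itv/= lte_fin; case: ifPn; rewrite -?EFinB ltry.
suff /andP[] : (0 <= \prod_(i < n) lebesgue_measure (A i) < +oo)%E by [].
elim/big_ind : _ => [|x y /andP[x0 xoo] /andP[y0 yoo]|//].
  by rewrite lee01 ltry.
by rewrite mule_ge0//= lte_mul_pinfty// ge0_fin_numE.
Qed.

End test_function_space.

(** * Extension by density between completions *)

Section extension.
Context {R : realType} {T : Type}.
Variables (V : set (T -> R)) (NX ND : (T -> R) -> \bar R).
Variables (X D : completeNormedModType R) (iX : (T -> R) -> X) (iD : (T -> R) -> D).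
Variable C : R.
Hypothesis C0 : 0 <= C.
Hypothesis Vlin : forall a u v, V u -> V v -> V (fun x => a * u x + v x).
Hypothesis hX : is_completion V NX iX.
Hypothesis hD : is_completion V ND iD.
Hypothesis NDX : forall u, V u -> (ND u <= C%:E * NX u)%E.

Let iD_lip u v : V u -> V v -> `|iD u - iD v| <= C * `|iX u - iX v|.
Proof.
move=> Vu Vv; have [linX normX _] := hX; have [linD normD _] := hD.
have Vw := Vlin (-1) Vv Vu.
have := NDX Vw; rewrite -normX// -normD// -EFinM lee_fin.
by rewrite linX// linD// !scaleN1r ![- _ + _]addrC.
Qed.

Let approx x e : 0 < e -> exists2 u, V u & `|x - iX u| < e.
Proof.
move=> e0; have [_ _ dX] := hX.
have [|y [xy [u Vu uy]]] := dX (ball x e) _ (ball_open x e).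
  by exists x; exact: ballxx.
by exists u => //; rewrite uy; move: xy; rewrite -ball_normE.
Qed.

(** The image of [x] is described by a bound against every [u] in [V], with no reference to an
    approximating sequence. Linearity, continuity and the extension property all follow from this
    one bound. *)
Let ext_spec x : exists y : D, forall u, V u -> `|y - iD u| <= C * `|x - iX u|.
Proof.
have /boolp.choice[w wP] : forall k : nat, exists u, V u /\ `|x - iX u| < k.+1%:R^-1.
  move=> k; have [|u Vu xu] := @approx x k.+1%:R^-1; first by rewrite invr_gt0.
  by exists u.
have small e : 0 < e -> \forall k \near \oo, C * k.+1%:R^-1 < e.
  move=> e0; have e1 : 0 < e / (C + 1) by rewrite divr_gt0// ltr_wpDl.
  near=> k; apply: (@le_lt_trans _ _ ((C + 1) * k.+1%:R^-1)).
    by rewrite ler_wpM2r ?invr_ge0// lerDl.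
  rewrite -ltr_pdivlMl ?ltr_wpDl// mulrC.
  by near: k; exact: (near_infty_natSinv_lt (PosNum e1)).
(* Taking [u = w m] gives the Cauchy property; keeping [u] arbitrary gives the bound on the
   limit. *)
have wlip u k : V u -> `|iD (w k) - iD u| <= C * `|x - iX u| + C * k.+1%:R^-1.
  move=> Vu; have [Vk xk] := wP k.
  apply: (le_trans (iD_lip Vk Vu)); rewrite -mulrDr ler_wpM2l//.
  by rewrite -(subrKA x) (le_trans (ler_normD _ _))// addrC lerD2l ltW// distrC.
have /cvg_ex[y yP] : cvg ((fun k => iD (w k)) @ \oo).
  apply: cauchy_cvg; apply: cauchy_exP => e e0.
  have e2 : 0 < e / 2 by rewrite divr_gt0.
  have [m _ mP] := small _ e2.
  exists (iD (w m)); exists m => // k /= mk.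
  rewrite -ball_normE /= distrC (le_lt_trans (wlip _ _ (wP m).1))//.
  rewrite (splitr e) ltrD//; last exact: mP.
  apply: le_lt_trans (mP m (leqnn m)).
  by rewrite ler_wpM2l// ltW// (wP m).2.
exists y => u Vu; apply/ler_addgt0Pr => e e0.
have e2 : 0 < e / 2 by rewrite divr_gt0.
near \oo => k.
apply: (le_trans (ler_distD (iD (w k)) _ _)).
rewrite [X in _ <= _ + X]splitr addrCA lerD//.
  by apply/ltW; near: k; move/cvgrPdist_lt : yP => /(_ _ e2).
by rewrite (le_trans (wlip _ k Vu))// lerD2l ltW//; near: k; exact: small.
Unshelve. all: by end_near.
Qed.

Lemma completion_extension : exists F : {linear X -> D},
  continuous F /\ forall u, V u -> F (iX u) = iD u.
Proof.
have [linX _ _] := hX; have [linD _ _] := hD.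
have /boolp.choice[F FP] := ext_spec.
have Flin : linear F.
  move=> a x y; apply/eqP; rewrite -subr_eq0 -normr_le0.
  apply/ler_addgt0Pr => e e0; rewrite add0r.
  (* Two errors occur, each at most [C * (|a| + 1)] times the precision [e / M]; the final 1 keeps
     [M] positive. *)
  pose M := 2 * C * (`|a| + 1) + 1.
  have M0 : 0 < M by rewrite ltr_wpDl// !mulr_ge0// addr_ge0.
  have d0 : 0 < e / M by rewrite divr_gt0.
  have [u Vu xu] := approx x d0.
  have [v Vv yv] := approx y d0.
  have Vuv := Vlin a Vu Vv.
  have h1 := FP (a *: x + y) _ Vuv; rewrite linX// linD// in h1.
  have h2 := FP x _ Vu; have h3 := FP y _ Vv.
  have -> : F (a *: x + y) - (a *: F x + F y) =
      (F (a *: x + y) - (a *: iD u + iD v)) - (a *: (F x - iD u) + (F y - iD v)).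
    by rewrite scalerBr addrACA -opprD opprB subrKA.
  have e1 : `|a *: x + y - (a *: iX u + iX v)| <= (`|a| + 1) * (e / M).
    rewrite opprD addrACA -scalerBr (le_trans (ler_normD _ _))// mulrDl mul1r.
    by rewrite normrZ lerD// ?ler_wpM2l// ltW.
  have e2 : `|a *: (F x - iD u) + (F y - iD v)| <= C * ((`|a| + 1) * (e / M)).
    rewrite (le_trans (ler_normD _ _))// normrZ mulrDl mul1r mulrDr lerD//.
      rewrite mulrCA ler_wpM2l// (le_trans h2)// ler_wpM2l// ltW//.
    by rewrite (le_trans h3)// ler_wpM2l// ltW.
  rewrite (le_trans (ler_normB _ _))// (le_trans (lerD (le_trans h1 (ler_wpM2l C0 e1)) e2))//.
  rewrite -mulr2n [leRHS](_ : e = M * (e / M)); last by rewrite mulrC divfK ?gt_eqF.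
  by rewrite mulrA -mulrnAl ler_wpM2r ?(ltW d0)// /M -mulr_natl mulrA lerDl.
have FC z : `|F z| <= C * `|z|.
  (* Density provides some [u] in [V]; the zero function is then reached as [-1 * u + u], and the
     specification at it is the operator bound. *)
  have [u Vu _] := approx 0 ltr01.
  have := FP z _ (Vlin (-1) Vu Vu).
  by rewrite linX// linD// !scaleN1r !addNr !subr0.
pose FL := GRing.isLinear.Build R X D *:%R F Flin.
pose Fl : {linear X -> D} := HB.pack F FL.
exists Fl; split => [x|u Vu] /=.
  apply/cvgrPdist_le => e e0.
  have e1 : 0 < e / (C + 1) by rewrite divr_gt0// ltr_wpDl.
  near=> z; rewrite -[F x - F z](linearB Fl) (le_trans (FC _))//.
  apply: (@le_trans _ _ ((C + 1) * `|x - z|)); first by rewrite ler_wpM2r// lerDl.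
  rewrite -ler_pdivlMl ?ltr_wpDl// mulrC.
  by near: z; apply: cvgr_dist_le => //; exact: cvg_id.
by apply/eqP; rewrite -subr_eq0 -normr_le0 (le_trans (FP _ _ Vu))// subrr normr0 mulr0.
Unshelve. all: by end_near.
Qed.

End extension.

Theorem proposition4p1 (R : realType) (n : nat) (n_gt0 : (0 < n)%N) (s p : R)
    (p_gt1 : 1 < p) (s_gt0 : 0 < s) (s_lt1 : s < 1)
    (Omega : set 'rV[R]_n) (openOmega : open Omega) :
  (forall u : 'rV[R]_n -> R, Cc_infty Omega u ->
     ((2 `^ (p * (1 - s)) * n%:R * unit_ball_volume R n)^-1%:E
        * D_norm s p u `^ p <= X_norm s p Omega u `^ p)%E) /\
  (forall (X D : completeNormedModType R)
      (iX : ('rV[R]_n -> R) -> X) (iD : ('rV[R]_n -> R) -> D),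
     is_completion (Cc_infty Omega) (X_norm s p Omega) iX ->
     is_completion (Cc_infty Omega) (D_norm s p) iD ->
     exists T : {linear X -> D},
       continuous T /\ forall u, Cc_infty Omega u -> T (iX u) = iD u).
Proof.
set C := 2 `^ (p * (1 - s)) * n%:R * unit_ball_volume R n.
have p0 : 0 < p by exact: lt_trans p_gt1.
have C0 : 0 <= C by rewrite mulr_ge0 ?fine_ge0// mulr_ge0// powR_ge0.
have leDX u : Cc_infty Omega u ->
    (D_norm s p u `^ p <= C%:E * X_norm s p Omega u `^ p)%E.
  move=> uC; rewrite /C EFinM fineK; last by rewrite ge0_fin_numE// unit_ball_finite.
  by apply: D_norm_le_X_norm => //; rewrite s_gt0.
split=> [u uC|X D iX iD hX hD].
  (* If [C] were 0, its inverse would be 0 and the left side would vanish; otherwise [C] is positive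
     and can be moved across. *)
  have [->|C1] := eqVneq C 0; first by rewrite invr0 mul0e poweR_ge0.
  by rewrite lee_pdivrMl ?leDX// lt0r C1.
(* The Lipschitz constant is the p-th root of [C], since the inequality compares p-th powers. *)
apply: (@completion_extension _ _ _ _ _ _ _ _ _ (C `^ p^-1) _ _ hX hD).
- exact: powR_ge0.
- by move=> a u v; exact: Cc_infty_lin.
move=> u uC; have pV : 0 <= p^-1 by rewrite invr_ge0 ltW.
have := le_poweR2r pV (poweR_ge0 _ _) (leDX u uC).
by rewrite poweRM ?poweR_ge0 ?lee_fin// -(poweRrM (D_norm s p u)) -(poweRrM (X_norm s p Omega u)) mulfV ?gt_eqF// !poweRe1 ?poweR_ge0// poweR_EFin.
Qed.
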